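(* Let $d,n\in\mathbb{N}$, $\alpha>1/2$, let $\boldsymbol{\gamma}=(\gamma_1,\gamma_2,\ldots)$ satisfy $1\ge\gamma_1\ge\gamma_2\ge\cdots>0$, let $M\ge1$ be real, let $\boldsymbol{z}\in\{0,1,\ldots,n-1\}^d$, and let $f\in C_{d,\alpha,\boldsymbol{\gamma}}$. The $L_2$ error of approximating $f$ by $A_{n,d,M}(f)$ (truncation of the cosine expansion to the hyperbolic cross $H_M$, with the cosine coefficients approximated by the tent-transformed rank-$1$ lattice rule with generating vector $\boldsymbol{z}$) is given by $$\|f-A_{n,d,M}(f)\|_{L_2([0,1]^d)}^2=\sum_{\boldsymbol{k}\in\mathbb{Z}_+^d\setminus H_M}|\hat f(\boldsymbol{k})|^2+\sum_{\boldsymbol{k}\in H_M}\left|\sum_{\boldsymbol{0}\ne\boldsymbol{h}\in\Lambda(\boldsymbol{z},n)^\perp}\ \sum_{\boldsymbol{\sigma}\in\{\pm1\}^d}\hat f(|\boldsymbol{\sigma}(\boldsymbol{h})+\boldsymbol{k}|)\,\frac{(\sqrt2)^{-|\boldsymbol{\sigma}(\boldsymbol{h})+\boldsymbol{k}|_0+|\boldsymbol{k}|_0}}{2^d}\right|^2.$$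
   Context: Notation. $\mathbb{Z}_+=\{0,1,2,\ldots\}$. For $\boldsymbol{k}\in\mathbb{Z}^d$, $|\boldsymbol{k}|_0$ is the number of non-zero components and $|\boldsymbol{k}|=(|k_1|,\ldots,|k_d|)$ is the componentwise absolute value. For $\boldsymbol{\sigma}\in\{\pm1\}^d$, $\boldsymbol{\sigma}(\boldsymbol{k})=(\sigma_1k_1,\ldots,\sigma_dk_d)$. The half-period cosine basis of $L_2([0,1]^d)$ is $\phi_{\boldsymbol{k}}(\boldsymbol{x})=(\sqrt2)^{|\boldsymbol{k}|_0}\prod_{j=1}^d\cos(\pi k_jx_j)$, $\boldsymbol{k}\in\mathbb{Z}_+^d$, and $\hat f(\boldsymbol{k})=\int_{[0,1]^d}f(\boldsymbol{x})\phi_{\boldsymbol{k}}(\boldsymbol{x})\,d\boldsymbol{x}$. For $\boldsymbol{k}\in\mathbb{Z}^d$, $r_{\alpha,\boldsymbol{\gamma}}(\boldsymbol{k})=\prod_{j=1}^d r_{\alpha,\gamma_j}(k_j)$, where $r_{\alpha,\gamma_j}(0)=1$ and $r_{\alpha,\gamma_j}(k)=|k|^{2\alpha}/\gamma_j$ for $k\ne0$. Cosine space: $C_{d,\alpha,\boldsymbol{\gamma}}$ is the space of complex-valued $f\in L_2([0,1]^d)$ with $\|f\|_{C_{d,\alpha,\boldsymbol{\gamma}}}^2=\sum_{\boldsymbol{k}\in\mathbb{Z}_+^d}|\hat f(\boldsymbol{k})|^2r_{\alpha,\boldsymbol{\gamma}}(\boldsymbol{k})<\infty$; for $\alpha>1/2$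 it is a reproducing kernel Hilbert space, each $f$ being identified with its continuous representative $\sum_{\boldsymbol{k}\in\mathbb{Z}_+^d}\hat f(\boldsymbol{k})\phi_{\boldsymbol{k}}$. Weighted hyperbolic cross: $H_M=\{\boldsymbol{k}\in\mathbb{Z}_+^d:r_{\alpha,\boldsymbol{\gamma}}(\boldsymbol{k})\le M\}$. Tent transformation: $\psi(x)=1-|2x-1|$ on $[0,1]$, applied componentwise. With $\boldsymbol{t}_i=\psi(\tfrac{i\boldsymbol{z}}n\bmod1)$, $i=1,\ldots,n$, the algorithm is $$A_{n,d,M}(f)(\boldsymbol{x})=\sum_{\boldsymbol{k}\in H_M}\Big(\frac1n\sum_{i=1}^nf(\boldsymbol{t}_i)\phi_{\boldsymbol{k}}(\boldsymbol{t}_i)\Big)\phi_{\boldsymbol{k}}(\boldsymbol{x}).$$ Dual lattice: $\Lambda(\boldsymbol{z},n)^\perp=\{\boldsymbol{h}\in\mathbb{Z}^d:\boldsymbol{h}\cdot\boldsymbol{z}\equiv0\pmod n\}$. *)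

(* Defs.v *)
From HB Require Import structures.
From mathcomp Require Import all_boot all_order all_algebra finmap.
From mathcomp Require Import all_classical all_reals all_analysis.
From mathcomp Require Import complex.
From mathcomp.analysis.showcase Require Import summability.

Set Implicit Arguments.
Unset Strict Implicit.
Unset Printing Implicit Defensive.

Import Order.TTheory GRing.Theory Num.Theory.
Import numFieldNormedType.Exports.

Local Open Scope classical_set_scope.
Local Open Scope ring_scope.

Section LebesgueTuple.
Context {R : realType}.
Local Notation RT := (measurableTypeR R).

Section Cons.
Variable n : nat.

Definition tuple_cons (p : RT * n.-tuple RT) : n.+1.-tuple RT :=
  [tuple of p.1 :: p.2].

Lemma measurable_tuple_cons : measurable_fun [set: RT * n.-tuple RT] tuple_cons.
Proof. exact: measurable_cons. Qed.

HB.instance Definition _ :=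
  isMeasurableFun.Build _ _ _ _ tuple_cons measurable_tuple_cons.

Variable mu : {sigma_finite_measure set n.-tuple RT -> \bar R}.

(* The image of lebesgue_measure \x mu under (x, t) |-> x :: t. *)
Definition lebesgue_cons : set (n.+1.-tuple RT) -> \bar R :=
  pushforward (product_measure1 (lebesgue_measure : set RT -> \bar R) mu)
    tuple_cons.

Let lebesgue_cons0 : lebesgue_cons set0 = 0%E.
Proof. exact: measure0. Qed.

Let lebesgue_cons_ge0 A : (0 <= lebesgue_cons A)%E.
Proof. exact: measure_ge0. Qed.

Let lebesgue_cons_sigma_additive : semi_sigma_additive lebesgue_cons.
Proof. exact: measure_semi_sigma_additive. Qed.

HB.instance Definition _ := isMeasure.Build _ _ _ lebesgue_cons
  lebesgue_cons0 lebesgue_cons_ge0 lebesgue_cons_sigma_additive.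

Let lebesgue_cons_sigma_finite : sigma_finite setT lebesgue_cons.
Proof.
have /sigma_finiteP[F [TF ndF Foo]] :=
  sigma_finiteT (lebesgue_measure : {sigma_finite_measure set RT -> \bar R}).
have /sigma_finiteP[G [TG ndG Goo]] := sigma_finiteT mu.
pose g (t : n.+1.-tuple RT) : RT * n.-tuple RT :=
  (tnth t ord0, [tuple of behead t]).
have mg : measurable_fun setT g.
  by apply: measurable_fun_pair; [exact: measurable_tnth|exact: measurable_behead].
exists (fun i => g @^-1` (F i `*` G i)).
  rewrite predeqE => t; split=> // _.
  have [k _ Fk] : (\bigcup_i F i) (g t).1 by rewrite -TF.
  have [l _ Gl] : (\bigcup_i G i) (g t).2 by rewrite -TG.
  exists (maxn k l) => //; split.
  - by move: (g t).1 Fk; exact/subsetPset/ndF/leq_maxl.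
  - by move: (g t).2 Gl; exact/subsetPset/ndG/leq_maxr.
move=> i; have [mF Fi] := Foo i; have [mG Gi] := Goo i.
have mFG : measurable (F i `*` G i) by exact: measurableX.
split; first by rewrite -[X in measurable X]setTI; exact: mg.
rewrite /lebesgue_cons /pushforward -comp_preimage.
rewrite (_ : g \o tuple_cons = id) ?preimage_id; last first.
  by apply/funext => -[x t] /=; congr pair; exact/val_inj.
by rewrite product_measure1E// lte_mul_pinfty// ge0_fin_numE.
Qed.

HB.instance Definition _ := Measure_isSigmaFinite.Build _ _ _ lebesgue_cons
  lebesgue_cons_sigma_finite.

End Cons.

(* The d-fold product of the Lebesgue measure, on the product sigma-algebra of
   d.-tuple R. *)
Fixpoint lebesgue_tuple n : {sigma_finite_measure set n.-tuple RT -> \bar R} :=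
  if n is n'.+1 then lebesgue_cons (lebesgue_tuple n')
  else \d_ ([tuple] : 0.-tuple RT).

End LebesgueTuple.

Notation normc := ComplexField.Normc.normc.

Section CosineSpace.
Context {R : realType} (d : nat).

Definition cube : set (d.-tuple (measurableTypeR R)) :=
  [set x | forall j, 0 <= tnth x j <= 1].

Definition cintegral (g : d.-tuple R -> R[i]) : R[i] :=
  Complex (\int[lebesgue_tuple d]_(x in cube) complex.Re (g x))
          (\int[lebesgue_tuple d]_(x in cube) complex.Im (g x)).

Definition L2normsq (g : d.-tuple R -> R[i]) : \bar R :=
  (\int[lebesgue_tuple d]_(x in cube) (normc (g x) ^+ 2)%:E)%E.

Definition in_L2 (g : d.-tuple R -> R[i]) : Prop :=
  [/\ measurable_fun cube (fun x => complex.Re (g x)),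
      measurable_fun cube (fun x => complex.Im (g x)) &
      (L2normsq g < +oo)%E].

(* Unconditional summation over an arbitrary index set: the net of finite
   partial sums, and its limit in R[i]. *)
Definition csum_net (I : choiceType) (D : set I) (a : I -> R[i]) :
    {fset I} -> (R[i])^o :=
  partial_sum (fun i => if i \in D then a i else 0 : (R[i])^o).

Definition csummable (I : choiceType) (D : set I) (a : I -> R[i]) : Prop :=
  cvg (csum_net D a @ totally).

Definition csum (I : choiceType) (D : set I) (a : I -> R[i]) : R[i] :=
  lim (csum_net D a @ totally).

Implicit Types k h : {ffun 'I_d -> int}.

Definition Zplus : set {ffun 'I_d -> int} := [set k | forall j, 0 <= k j].

Definition nnz k : nat := #|[pred j | k j != 0]|.

Definition absv k : {ffun 'I_d -> int} := [ffun j => `|k j|].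

(* The Boolean vector s encodes the signs (-1) ^+ s j. *)
Definition sgn_act (s : {ffun 'I_d -> bool}) h : {ffun 'I_d -> int} :=
  [ffun j => (-1) ^+ s j * h j].

Definition phi k (x : d.-tuple R) : R :=
  Num.sqrt 2 ^+ nnz k * \prod_(j < d) cos (pi * (k j)%:~R * tnth x j).

Definition fhat (f : d.-tuple R -> R[i]) k : R[i] :=
  cintegral (fun x => f x * (phi k x)%:C%C).

Section Weights.
Variables (alpha : R) (gamma : nat -> R).

(* gamma is indexed from 0, matching j : 'I_d. *)
Definition weight1 (g : R) (m : int) : R :=
  if m == 0 then 1 else (`|m|%:~R `^ (2 * alpha)) / g.

Definition weight k : R := \prod_(j < d) weight1 (gamma j) (k j).

Definition cosine_normsq (f : d.-tuple R -> R[i]) : \bar R :=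
  (\esum_(k in Zplus) (normc (fhat f k) ^+ 2 * weight k)%:E)%E.

Definition cosine_space (f : d.-tuple R -> R[i]) : Prop :=
  in_L2 f /\ (cosine_normsq f < +oo)%E.

Definition hyperbolic_cross (M : R) : set {ffun 'I_d -> int} :=
  [set k | Zplus k /\ weight k <= M].

End Weights.

(* An element of the cosine space is an L2 function up to null sets; its point
   values are those of its continuous representative, the sum of its cosine
   series. *)
Definition crep (f : d.-tuple R -> R[i]) (x : d.-tuple R) : R[i] :=
  csum Zplus (fun k => fhat f k * (phi k x)%:C%C).

Definition tent (x : R) : R := 1 - `|2 * x - 1|.

Definition frac (x : R) : R := x - (Num.floor x)%:~R.

Section Lattice.
Variables (n : nat) (z : {ffun 'I_d -> 'I_n}).

Definition tent_node (i : nat) : d.-tuple R :=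
  [tuple tent (frac (i%:R * (z j : nat)%:R / n%:R)) | j < d].

Definition dual_lattice : set {ffun 'I_d -> int} :=
  [set h | (\sum_(j < d) h j * (z j : nat)%:Z = 0 %[mod n%:Z])%Z].

(* The sum over the hyperbolic cross is finite when alpha > 0 and the weights
   are positive; \sum_(_ \in _) is 0 by convention on infinite supports. *)
Definition lattice_approx (alpha : R) (gamma : nat -> R) (M : R)
    (f : d.-tuple R -> R[i]) (x : d.-tuple R) : R[i] :=
  \sum_(k \in hyperbolic_cross alpha gamma M)
    (n%:R^-1 * (\sum_(1 <= i < n.+1)
       crep f (tent_node i) * (phi k (tent_node i))%:C%C)) * (phi k x)%:C%C.

End Lattice.
End CosineSpace.

(* Main.v *)
(* The tent map turns cosines into periodic ones: cos (pi l psi(y mod 1)) equals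
   cos (2 pi l y), so the cosine series of f at a node is the series of
   f^(|h|) sqrt2^(-|h|_0) exp(2 pi i h.z i / n) over h in Z^d, absolutely
   summable because 2 alpha > 1.  Multiplying by phi_k, written as a sum of
   exponentials over sign vectors, and averaging over the nodes keeps the
   frequencies of the dual lattice only: the lattice coefficient minus f^(k) is
   the aliasing sum over the nonzero dual vectors, the vector 0 giving f^(k).
   The error formula is then Parseval's identity for f - A(f), which rests on
   the density of trigonometric polynomials in L2: the sets whose indicator is a
   bounded pointwise limit of trigonometric polynomials form a pi-system
   containing the half-spaces, hence generating the measurable sets. *)

Require Import Defs.
From HB Require Import structures.
From mathcomp Require Import all_boot all_order all_algebra finmap.
From mathcomp Require Import all_classical all_reals all_analysis.
From mathcomp Require Import measurable_realfun complex ring lra zify.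
From mathcomp.analysis.showcase Require summability.

Import Order.TTheory GRing.Theory Num.Theory.
Import numFieldNormedType.Exports.
Local Open Scope classical_set_scope.
Local Open Scope ring_scope.

Set Implicit Arguments.
Unset Strict Implicit.
Unset Printing Implicit Defensive.

(** * Integration over the cube *)

(** The analytic and the arithmetic halves meet only at the end. Subtracting from f any finite
    combination of basis functions with frequencies in [s] changes only the coefficients in [s], so
    the squared error splits for arbitrary coefficients on H_M, and the lattice rule enters through
    the differences [lattice_coef] - f^(k) alone. In the arithmetic half the obstacle is
    rearrangement: a sum over Z^d is an unconditional limit, which must exist before it is grouped,
    averaged or shifted. Existence comes from a <= a^2 r + 1/r with a = |f^(k)| and r the weight:
    the norm of f bounds the sum of a^2 r, and the sum of 1/r over Z^d factors into one-dimensional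
    p-series with p = 2 alpha. In the analytic half, cos(pi x) decreases on [0,1], so the half-space
    x_j > a is where a trigonometric polynomial stays below a constant, and large powers of
    polynomials converge pointwise to such an indicator. *)

Section CubeMeasure.
Context {R : realType}.
Local Notation RT := (measurableTypeR R).
Local Notation leb := (lebesgue_measure : {sigma_finite_measure set RT -> \bar R}).

Lemma lebesgue_unit_interval : leb `[0%R, 1%R]%classic = 1%E.
Proof.
transitivity ((lebesgue_measure : set RT -> \bar R) `[0%R, 1%R]%classic) => //.
by rewrite lebesgue_measure_itv /= lte_fin ltr01 -EFinB subr0.
Qed.

Lemma measurable_cube d : measurable (@cube R d).
Proof.
have -> : @cube R d = \bigcap_(j in [set: 'I_d])
    ((fun x : d.-tuple RT => tnth x j) @^-1` [set` `[0, 1 : R]]).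
  apply/seteqP; split => [x cx j _|x cx j].
    by rewrite /= in_itv /=; exact: cx.
  by have := cx j I; rewrite /= in_itv.
apply: fin_bigcap_measurable => //.
move=> j _; rewrite -[X in measurable X]setTI.
by apply: measurable_tnth => //; exact: measurable_itv.
Qed.

Lemma cube_cons d : @tuple_cons R d @^-1` (@cube R d.+1) =
  [set` `[0, 1 : R]] `*` (@cube R d).
Proof.
apply/seteqP; split => [[x t] /= cx|[x t] /= [cx ct] j].
  split; first by rewrite /= in_itv /=; exact: (cx ord0).
  by move=> j; have := cx (lift ord0 j); rewrite tnthS.
case: (unliftP ord0 j) => [i ->|->]; first by rewrite tnthS; exact: ct.
by move: cx; rewrite in_itv.
Qed.

Lemma lebesgue_tuple_cube d : lebesgue_tuple d (@cube R d) = 1%E.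
Proof.
elim: d => [|d IH].
  by rewrite /= diracE mem_set//; case.
rewrite /= /lebesgue_cons /pushforward cube_cons product_measure1E//;
  [|exact: measurable_cube].
rewrite IH mule1; exact: lebesgue_unit_interval.
Qed.

End CubeMeasure.

(** * Fubini on the cube for products of functions of one coordinate *)

Section ProductIntegral.
Context {R : realType}.
Local Notation RT := (measurableTypeR R).
Local Notation leb := (lebesgue_measure : {sigma_finite_measure set RT -> \bar R}).

Lemma bounded_on (T : Type) (A : set T) (f : T -> R) (B : R) :
  (forall x, A x -> `|f x| <= B) -> [bounded f x | x in A].
Proof.
move=> fB; exists B; split; first exact: num_real.
by move=> M BM x Ax /=; apply: (le_trans (fB _ Ax)); exact: ltW.
Qed.

Lemma integral_prodM d1 d2 (T1 : measurableType d1) (T2 : measurableType d2)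
    (m1 : {sigma_finite_measure set T1 -> \bar R})
    (m2 : {sigma_finite_measure set T2 -> \bar R})
    (A : set T1) (B : set T2) (a : T1 -> R) (b : T2 -> R) :
  measurable A -> measurable B -> (m1 A < +oo)%E -> (m2 B < +oo)%E ->
  measurable_fun setT a -> measurable_fun setT b ->
  (forall x, `|a x| <= 1) -> (forall x, `|b x| <= 1) ->
  \int[(m1 \x m2)%E]_(p in A `*` B) (a p.1 * b p.2) =
  (\int[m1]_(x in A) a x) * (\int[m2]_(y in B) b y).
Proof.
move=> mA mB fA fB ma mb a1 b1.
have ia : m1.-integrable A (EFin \o a).
  apply: measurable_bounded_integrable => //; first exact: measurable_funTS.
  exact: (@bounded_on _ _ _ 1).
have ib : m2.-integrable B (EFin \o b).
  apply: measurable_bounded_integrable => //; first exact: measurable_funTS.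
  exact: (@bounded_on _ _ _ 1).
have mab : measurable_fun setT (fun p : T1 * T2 => a p.1 * b p.2).
  by apply: measurable_funM; exact: measurableT_comp.
have iab : (m1 \x m2)%E.-integrable (A `*` B) (EFin \o (fun p : T1 * T2 => a p.1 * b p.2)).
  apply: measurable_bounded_integrable => //.
  - exact: measurableX.
  - by rewrite [ltLHS]product_measure1E//; apply: lte_mul_pinfty => //; rewrite ge0_fin_numE.
  - exact: measurable_funTS.
  - by apply: (@bounded_on _ _ _ 1) => p _; rewrite normrM mulr_ile1.
(* Fubini is applied on the whole product space, so the restriction to [A]*[B] is first moved into
   the integrand, where it factors as a product of two restrictions. *)
rewrite /Rintegral integral_mkcond.
move/integrable_mkcond : iab => /(_ (measurableX mA mB)) iab.
rewrite -integral12_prod_meas1//.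
transitivity (fine (\int[m1]_x ((\int[m2]_(y in B) b y)%:E * ((a \_ A) x)%:E))%E).
  congr fine; apply: eq_integral => x _; rewrite /fubini_F.
  rewrite (_ : (fun y => _) =
      (fun y => ((a \_ A) x)%:E * ((EFin \o b) \_ B) y)%E); last first.
    apply/funext => y; rewrite /patch in_setX /=.
    by case: (x \in A); case: (y \in B); rewrite /= ?mul0e ?mule0.
  rewrite integralZl//; last exact/(integrable_mkcond _ mB).
  rewrite -integral_mkcond muleC; congr (_ * _)%E.
  by rewrite /Rintegral fineK//; exact: (integrable_fin_num mB ib).
rewrite integralZl//; last first.
  by have := (integrable_mkcond _ mA).1 ia; rewrite restrict_EFin.
rewrite fineM//; last first.
  by have := integrable_fin_num measurableT ((integrable_mkcond _ mA).1 ia); rewrite restrict_EFin.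
rewrite mulrC; congr (_ * _).
by rewrite [in RHS]integral_mkcond restrict_EFin.
Qed.

Lemma measurable_tuple_prod d (g : 'I_d -> RT -> R) :
  (forall j, measurable_fun setT (g j)) ->
  measurable_fun setT (fun x : d.-tuple RT => \prod_(j < d) g j (tnth x j)).
Proof.
move=> mg; apply: measurable_prod => j _.
exact: (measurableT_comp (mg j) (measurable_tnth j)).
Qed.

Lemma Rintegral_cube_prod d (g : 'I_d -> RT -> R) :
  (forall j, measurable_fun setT (g j)) -> (forall j x, `|g j x| <= 1) ->
  \int[lebesgue_tuple d]_(x in @cube R d) \prod_(j < d) g j (tnth x j) =
  \prod_(j < d) \int[leb]_(x in `[0, 1]) g j x.
Proof.
elim: d g => [|d IH] g mg g1.
  rewrite big_ord0 (@eq_Rintegral _ _ _ _ _ (fun=> 1)); last by move=> x _; rewrite big_ord0.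
  rewrite Rintegral_cst; last exact: measurable_cube.
  rewrite mul1r; exact: (congr1 fine (@lebesgue_tuple_cube R 0)).
have b1 (x : d.+1.-tuple RT) : `|\prod_(j < d.+1) g j (tnth x j)| <= 1.
  by rewrite normr_prod; apply: prodr_ile1 => j; rewrite normr_ge0 g1.
have c1 (x : d.-tuple RT) : `|\prod_(j < d) g (lift ord0 j) (tnth x j)| <= 1.
  by rewrite normr_prod; apply: prodr_ile1 => j; rewrite normr_ge0 g1.
have mcube := @measurable_cube R.
have leb1 : (leb `[0%R, 1%R]%classic < +oo)%E.
  by rewrite [ltLHS]lebesgue_unit_interval ltry.
rewrite big_ord_recl -IH//.
rewrite -(@integral_prodM _ _ _ _ leb (lebesgue_tuple d) _ _ (g ord0)
  (fun t => \prod_(j < d) g (lift ord0 j) (tnth t j)))//; first last.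
- by apply: (@measurable_tuple_prod d (fun j => g (lift ord0 j))).
- by rewrite [ltLHS]lebesgue_tuple_cube ltry.
- exact: mcube.
rewrite /Rintegral; congr fine.
(* Exposing the measure as a pushforward, which holds by conversion, permits the change of variables
   back to pairs. *)
transitivity (\int[pushforward (leb \x lebesgue_tuple d)%E (@tuple_cons R d)]_(x in @cube R d.+1)
   (\prod_(j < d.+1) g j (tnth x j))%:E)%E => //.
rewrite integral_pushforward//.
- rewrite cube_cons; apply: eq_integral => -[x t] _ /=.
  rewrite big_ord_recl /=; congr (_ * _)%:E.
  by apply: eq_bigr => j _; rewrite tnthS.
- by apply/measurable_EFinP; exact: measurable_tuple_prod.
- rewrite cube_cons.
  apply: (@measurable_bounded_integrable _ _ _ _
    ((fun x : d.+1.-tuple RT => \prod_(j < d.+1) g j (tnth x j)) \o @tuple_cons R d)).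
  + exact: measurableX.
  + rewrite [ltLHS]product_measure1E; [|exact: measurable_itv|exact: mcube].
    apply: lte_mul_pinfty => //; first by rewrite ge0_fin_numE.
    by rewrite [ltLHS]lebesgue_tuple_cube ltry.
  + apply: measurable_funTS; apply: measurableT_comp; first exact: measurable_tuple_prod.
    exact: measurable_tuple_cons.
  + by apply: (@bounded_on _ _ _ 1) => p _; exact: b1.
- exact: mcube.
Qed.

End ProductIntegral.

(** * Cosine integrals in one variable *)

Section CosineIntegrals.
Context {R : realType}.
Local Notation RT := (measurableTypeR R).
Local Notation leb := (lebesgue_measure : {sigma_finite_measure set RT -> \bar R}).

Lemma sin_int_pi (m : int) : sin (pi * m%:~R) = 0 :> R.
Proof.
have N (n : nat) : sin (pi * n%:R) = 0 :> R.
  elim: n => [|n IH]; first by rewrite mulr0 sin0.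
  by rewrite -natr1 mulrDr mulr1 sinD IH sinpi mul0r mulr0 addr0.
case: m => n; first exact: N.
by rewrite NegzE mulrNz mulrN sinN N oppr0.
Qed.

Lemma Rintegral_cos_int (m : int) :
  \int[leb]_(x in `[0, 1]) cos (pi * m%:~R * x) = (m == 0)%:R :> R.
Proof.
have [->|m0] := eqVneq m 0.
  rewrite (@eq_Rintegral _ _ _ _ _ (fun=> 1)); last by move=> x _; rewrite mulr0 mul0r cos0.
  by rewrite Rintegral_cst// mul1r; exact: (congr1 fine lebesgue_unit_interval).
set w : R := pi * m%:~R.
have w0 : w != 0 by rewrite mulf_neq0// ?intr_eq0// gt_eqF ?pi_gt0.
pose F : R -> R := fun x => w^-1 * sin (w * x).
have dF (x : R) : is_derive x 1 F (cos (w * x)).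
  have H : is_derive x 1 (fun x => w * x) w.
    have := @is_deriveZ R R R id w x 1 1 _; rewrite /GRing.scale /= mulr1; exact.
  have H2 := @is_derive1_comp R sin (fun x => w * x) x _ _ (is_derive_sin (w * x)) H.
  have := @is_deriveZ R R R (sin \o (fun x => w * x)) w^-1 x 1 _ H2.
  by rewrite /GRing.scale /= mulrCA mulVf// mulr1; exact.
have ccos : continuous (fun x : R => cos (w * x)).
  move=> x; apply: (@continuous_comp _ _ _ (fun x => w * x) cos).
    exact: mulrl_continuous.
  exact: continuous_cos.
rewrite /Rintegral (@continuous_FTC2 R (fun x => cos (w * x)) F 0 1)//.
- by rewrite /F mulr0 sin0 mulr0 sube0 mulr1 sin_int_pi mulr0.
- by apply: continuous_subspaceT.
- have cF : continuous F.
    by move=> x; apply/differentiable_continuous/derivable1_diffP; case: (dF x).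
  split.
  + by move=> x _; case: (dF x).
  + by apply: cvg_at_right_filter; exact: cF.
  + by apply: cvg_at_left_filter; exact: cF.
- by move=> x _; rewrite derive1E; case: (dF x).
Qed.

Lemma cos_mul_cos (a b : R) : cos a * cos b = 2^-1 * (cos (a + b) + cos (a - b)).
Proof. by rewrite cosB cosD; field. Qed.

Lemma measurable_cosZ (w : R) : measurable_fun setT (fun x : RT => cos (w * x) : R).
Proof.
apply: (measurableT_comp (@continuous_measurable_fun _ cos (@continuous_cos R))).
exact: mulrl_measurable.
Qed.

Lemma norm_cos_le1 (x : R) : `|cos x| <= 1.
Proof. by rewrite ler_norml cos_geN1 cos_le1. Qed.

Lemma Rintegral_cos_cos (m l : int) :
  \int[leb]_(x in `[0, 1]) (cos (pi * m%:~R * x) * cos (pi * l%:~R * x)) =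
  2^-1 * ((m + l == 0)%:R + (m - l == 0)%:R) :> R.
Proof.
have mI : measurable (`[0, 1]%classic : set RT) by exact: measurable_itv.
have ic (k : int) :
    leb.-integrable `[0, 1]%classic (EFin \o (fun x : RT => cos (pi * k%:~R * x))).
  apply: measurable_bounded_integrable => //; first by rewrite [ltLHS]lebesgue_unit_interval ltry.
    apply: measurable_funTS; exact: measurable_cosZ.
  by apply: (@bounded_on _ _ _ _ 1) => x _; exact: norm_cos_le1.
rewrite -!Rintegral_cos_int -(RintegralD mI (ic (m + l)) (ic (m - l))).
rewrite -(RintegralZl _ mI (integrableD mI (ic (m + l)) (ic (m - l)))).
apply: eq_Rintegral => x _; rewrite cos_mul_cos; congr (_ * (cos _ + cos _)).
  by rewrite intrD; ring.
by rewrite intrB; ring.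
Qed.

End CosineIntegrals.

(** * The algebra of trigonometric polynomials *)

Section TrigPoly.
Context {R : realType} {d : nat}.
Local Notation RT := (measurableTypeR R).
Local Notation K := {ffun 'I_d -> int}.
Local Notation X := (d.-tuple RT).
Local Notation mu := (@lebesgue_tuple R d).
Local Notation cube := (@cube R d).
Implicit Types (k l : K) (p q : X -> R).

Definition cosmono k (x : X) : R := \prod_(j < d) cos (pi * (k j)%:~R * tnth x j).

Lemma phiE k x : phi k x = Num.sqrt 2 ^+ nnz k * cosmono k x.
Proof. by []. Qed.

Lemma measurable_cosmono k : measurable_fun setT (cosmono k).
Proof.
apply: (@measurable_tuple_prod R d (fun j x => cos (pi * (k j)%:~R * x))) => j.
exact: measurable_cosZ.
Qed.

Lemma norm_cosmono k x : `|cosmono k x| <= 1.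
Proof. by rewrite normr_prod; apply: prodr_ile1 => j; rewrite normr_ge0 norm_cos_le1. Qed.

(** The product-to-sum formula in each coordinate gives a two-term sum indexed by a sign;
    distributing the product over these sums yields one term per sign vector. Trigonometric
    polynomials are therefore closed under products. *)
Lemma cosmonoM k l x : cosmono k x * cosmono l x =
  \sum_(s : {ffun 'I_d -> bool}) 2^-1 ^+ d * cosmono (k + sgn_act s l) x.
Proof.
rewrite /cosmono -big_split /=.
under eq_bigr => j _.
  rewrite (_ : _ * _ = \sum_(b : bool)
      2^-1 * cos (pi * (k j + (-1) ^+ b * l j)%:~R * tnth x j)).
    over.
  rewrite big_bool /= expr0 expr1 mul1r mulN1r cos_mul_cos -mulrDr addrC.
  by rewrite !intrD mulrNz; congr (_ * (cos _ + cos _)); ring.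
rewrite bigA_distr_bigA /=; apply: eq_bigr => s _.
rewrite big_split /= prodr_const card_ord; congr (_ * _).
by apply: eq_bigr => j _; rewrite !ffunE.
Qed.

(** Frequencies range over Z^d, with repetitions allowed, which makes closure under sums and
    products immediate; [trigpoly_phi] later folds them onto distinct nonnegative frequencies. *)
Definition trigpoly p := exists s : seq (R * K),
  p = fun x => \sum_(c <- s) c.1 * cosmono c.2 x.

Lemma trigpoly_mono a k : trigpoly (fun x => a * cosmono k x).
Proof. by exists [:: (a, k)]; apply/funext => x; rewrite big_seq1. Qed.

Lemma trigpolyD p q : trigpoly p -> trigpoly q -> trigpoly (fun x => p x + q x).
Proof.
move=> [s ->] [t ->]; exists (s ++ t); apply/funext => x.
by rewrite big_cat.
Qed.

Lemma trigpoly_cst a : trigpoly (fun=> a).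
Proof.
have := trigpoly_mono a 0; congr trigpoly; apply/funext => x.
by rewrite /cosmono big1 ?mulr1// => j _; rewrite !ffunE mulr0 mul0r cos0.
Qed.

Lemma trigpoly_sum (I : Type) (s : seq I) (p : I -> X -> R) :
  (forall i, trigpoly (p i)) -> trigpoly (fun x => \sum_(i <- s) p i x).
Proof.
move=> tp; elim: s => [|i s IH].
  by under eq_fun do rewrite big_nil; exact: trigpoly_cst.
by under eq_fun do rewrite big_cons; exact: trigpolyD.
Qed.

Lemma trigpolyM p q : trigpoly p -> trigpoly q -> trigpoly (fun x => p x * q x).
Proof.
move=> [s ->] [t ->].
under eq_fun do rewrite big_distrl /=.
apply: trigpoly_sum => a.
under eq_fun do rewrite big_distrr /=.
apply: trigpoly_sum => b.
under eq_fun => x do rewrite mulrACA cosmonoM big_distrr /=.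
apply: trigpoly_sum => c.
under eq_fun => x do rewrite mulrA.
exact: trigpoly_mono.
Qed.

Lemma trigpolyZ a p : trigpoly p -> trigpoly (fun x => a * p x).
Proof. exact: (trigpolyM (trigpoly_cst a)). Qed.

Lemma trigpolyX p n : trigpoly p -> trigpoly (fun x => p x ^+ n).
Proof.
move=> tp; elim: n => [|n IH].
  by under eq_fun do rewrite expr0; exact: trigpoly_cst.
by under eq_fun do rewrite exprS; exact: trigpolyM.
Qed.

Lemma trigpoly_cos (j : 'I_d) : trigpoly (fun x => cos (pi * tnth x j)).
Proof.
have := trigpoly_mono 1 [ffun i => (i == j)%:Z]; congr trigpoly; apply/funext => x.
rewrite mul1r /cosmono (bigD1 j)//= big1 ?mulr1.
  by rewrite ffunE eqxx mulr1.
by move=> i /negbTE ij; rewrite ffunE ij mulr0 mul0r cos0.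
Qed.

Lemma measurable_trigpoly p : trigpoly p -> measurable_fun setT p.
Proof.
move=> [s ->]; apply: measurable_sum => c.
by apply: measurable_funM => //; exact: measurable_cosmono.
Qed.

End TrigPoly.
Arguments cosmono {R d}.
Arguments trigpoly {R d}.

(** * Density of trigonometric polynomials *)

Section Density.
Context {R : realType} {d : nat}.
Local Notation RT := (measurableTypeR R).
Local Notation K := {ffun 'I_d -> int}.
Local Notation X := (d.-tuple RT).
Local Notation mu := (@lebesgue_tuple R d).
Local Notation cube := (@cube R d).
Implicit Types (k l : K) (p q f g : X -> R).

Lemma bernoulli_ineq (x : R) n : -1 <= x -> 1 + n%:R * x <= (1 + x) ^+ n.
Proof.
move=> x1; elim: n => [|n IH]; first by rewrite mul0r addr0 expr0.
rewrite exprSr; apply: (@le_trans _ _ ((1 + n%:R * x) * (1 + x))).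
  rewrite -natr1 -subr_ge0.
  rewrite (_ : _ - _ = n%:R * x ^+ 2); last by ring.
  by rewrite mulr_ge0// sqr_ge0.
by rewrite ler_wpM2r// -lerBlDl sub0r.
Qed.

(* The exponents are chosen so that [n * 4^n * y^(2n)] tends to infinity for
   [y >= 1/2], boundary included, and to 0 for [y < 1/2]. *)
Definition threshold n (y : R) : R := (1 - y ^+ n.*2) ^+ (n * 4 ^ n).

Lemma threshold_itv n (y : R) : 0 <= y <= 1 -> 0 <= threshold n y <= 1.
Proof.
move=> /andP[y0 y1].
have /andP[a b] : 0 <= 1 - y ^+ n.*2 <= 1.
  by rewrite subr_ge0 exprn_ile1//= gerBl exprn_ge0.
by rewrite /threshold exprn_ge0//= exprn_ile1.
Qed.

Lemma threshold_mulE n (y : R) : (n * 4 ^ n)%:R * y ^+ n.*2 = n%:R * (2 * y) ^+ n.*2.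
Proof.
rewrite natrM natrX -mulrA; congr (_ * _).
have e4 : 2 ^+ 2 = 4%:R :> R by ring.
have -> : (4%:R : R) ^+ n = 2 ^+ n.*2 by rewrite -mul2n exprM e4.
by rewrite exprMn.
Qed.

(** Put v = y^(2n) and N = n 4^n, so N v = n (2y)^(2n). If y < 1/2, Bernoulli gives (1 - v)^N >= 1 -
    N v, which tends to 1. If y >= 1/2, then (1 - v)^N (1 + v)^N <= 1 while (1 + v)^N >= 1 + N v >=
    n + 1. *)
Lemma cvg_threshold (y : R) : 0 <= y <= 1 ->
  (fun n => threshold n y) @ \oo --> ((y < 2^-1)%R%:R : R).
Proof.
move=> /andP[y0 y1]; have [ylt|yge] := ltP y 2^-1.
  set r := 2 * y.
  have r0 : 0 <= r by rewrite mulr_ge0.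
  have r1 : r < 1 by rewrite /r mulrC -ltr_pdivlMr// mul1r.
  pose h := (1 - r) .
  have h0 : 0 < h by rewrite subr_gt0.
  (* Each of the n terms of the geometric sum of r^i, i < n, is at least r^n, and that sum is at
     most 1/(1 - r). In n r^(2n) one factor r^n thus absorbs n and the other tends to 0. *)
  have nr n : n%:R * r ^+ n <= h^-1.
    rewrite -[leRHS]mul1r ler_pdivlMr// /h.
    have : n%:R * r ^+ n <= \sum_(0 <= i < n) r ^+ i.
      rewrite -[n in leLHS]subn0 mulr_natl -sumr_const_nat.
      rewrite big_nat [leRHS]big_nat; apply: ler_sum => i /andP[_ ni].
      by rewrite subn0 ler_wiXn2l ?(ltW r1) ?(ltnW ni).
    move=> /(ler_wpM2r (ltW h0)) /le_trans; apply.
    rewrite big_mkord mulrC /h -[1 - r]opprB mulNr -subrX1 opprB gerBl.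
    exact: exprn_ge0.
  apply: (@squeeze_cvgr _ _ _ _ (fun n => 1 - h^-1 * r ^+ n) (fun=> 1)).
  - apply: nearW => n.
    have /andP[_ ->] : 0 <= threshold n y <= 1 by apply: threshold_itv; rewrite y0.
    rewrite andbT.
    apply: (@le_trans _ _ (1 + (n * 4 ^ n)%:R * - y ^+ n.*2)).
      rewrite mulrN threshold_mulE -/r lerD2l lerN2 -addnn exprD mulrA.
      by rewrite ler_wpM2r// exprn_ge0.
    by apply: bernoulli_ineq; rewrite lerN2 exprn_ile1.
  - rewrite -[X in _ --> X]subr0 -[X in _ --> _ - X](mulr0 h^-1).
    apply: cvgB; first exact: cvg_cst.
    apply: cvgMr; apply: cvg_expr; by rewrite ger0_norm.
  - exact: cvg_cst.
apply: (@squeeze_cvgr _ _ _ _ (fun=> 0) (fun n => n.+1%:R^-1)).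
- apply: nearW => n.
  have -> /= : 0 <= threshold n y.
    by have /andP[] : 0 <= threshold n y <= 1 by apply: threshold_itv; rewrite y0.
  rewrite -[leRHS]mul1r ler_pdivlMr//.
  set v := y ^+ n.*2.
  have v0 : 0 <= v by exact: exprn_ge0.
  have v1 : v <= 1 by exact: exprn_ile1.
  have H : n.+1%:R <= (1 + v) ^+ (n * 4 ^ n).
    apply: le_trans (bernoulli_ineq _ _); last by rewrite (le_trans _ v0).
    rewrite threshold_mulE -nat1r lerD2l ler_peMr// exprn_ege1//.
    by rewrite mulrC -ler_pdivrMr// mul1r.
  apply: (@le_trans _ _ (threshold n y * (1 + v) ^+ (n * 4 ^ n))).
    rewrite ler_wpM2l//.
    by have /andP[] : 0 <= threshold n y <= 1 by apply: threshold_itv; rewrite y0.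
  rewrite /threshold -exprMn exprn_ile1//.
    by rewrite mulr_ge0 ?subr_ge0// addr_ge0.
  by rewrite -/v -subr_sqr expr1n gerBl sqr_ge0.
- exact: cvg_cst.
- exact: cvg_harmonic.
Qed.

(** Values in [0,1] survive products, which gives stability under intersection, and they supply a
    constant dominating function for the passage to L2. *)
Definition boundedly_approximable (A : set X) := measurable A /\
  exists s : nat -> X -> R,
    [/\ forall n, trigpoly (s n), forall n x, cube x -> 0 <= s n x <= 1 &
        forall x, cube x -> s ^~ x @ \oo --> (\1_A x : R)].

Lemma approximableI : setI_closed boundedly_approximable.
Proof.
move=> A B [mA [s [ts s01 sA]]] [mB [t [tt t01 tB]]]; split; first exact: measurableI.
exists (fun n x => s n x * t n x); split => [n|n x cx|x cx].
- exact: trigpolyM.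
- have /andP[? ?] := s01 n x cx; have /andP[? ?] := t01 n x cx.
  by rewrite mulr_ge0//= mulr_ile1.
- by rewrite indicI /=; apply: cvgM; [exact: sA|exact: tB].
Qed.

Lemma approximable_ray (j : 'I_d) (a : R) :
  boundedly_approximable ((fun x : X => tnth x j) @^-1` `]a, +oo[%classic).
Proof.
split.
  by rewrite -[X in measurable X]setTI; apply: measurable_tnth => //; exact: measurable_itv.
have indicE x : \1_((fun x : X => tnth x j) @^-1` `]a, +oo[%classic) x = (a < tnth x j)%R%:R :> R.
  rewrite indicE; congr (nat_of_bool _)%:R; apply/idP/idP.
    by rewrite inE /= in_itv /= andbT.
  by move=> H; rewrite inE /= in_itv /= andbT.
(* For [a] outside [0,1] the indicator is constant on the cube; otherwise pi a lies in [0,pi], where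
   cosine is strictly decreasing. *)
have [a0|a0] := ltP a 0.
  exists (fun _ _ => 1); split => [n|n x _|x cx]; first exact: trigpoly_cst.
    by rewrite ler01 lexx.
  rewrite indicE (lt_le_trans a0) ?mulr1n; first exact: cvg_cst.
  by have /andP[] := cx j.
have [a1|a1] := ltP 1 a.
  exists (fun _ _ => 0); split => [n|n x _|x cx]; first exact: trigpoly_cst.
    by rewrite ler01 lexx.
  rewrite indicE ltNge (le_trans _ (ltW a1)); first exact: cvg_cst.
  by have /andP[] := cx j.
(* The difference of two cosines lies in [-2,2], so the factor 1/4 and the shift 1/2 bring [p] into
   [0,1] and place the cut cos(pi x_j) = cos(pi a) at the value 1/2 singled out by [threshold]. *)
pose p (x : X) : R := 2^-1 + 4^-1 * (cos (pi * tnth x j) + (- cos (pi * a))).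
have tp : trigpoly p.
  apply: trigpolyD; first exact: trigpoly_cst.
  apply: trigpolyZ; apply: trigpolyD; [exact: trigpoly_cos|exact: trigpoly_cst].
have p01 x : 0 <= p x <= 1.
  have := cos_le1 (pi * tnth x j); have := cos_geN1 (pi * tnth x j).
  have := cos_le1 (pi * a); have := cos_geN1 (pi * a).
  rewrite /p; set u := cos _; set v := cos _ => ? ? ? ?.
  by apply/andP; split; lra.
exists (fun n x => threshold n (p x)); split => [n|n x cx|x cx].
- apply: trigpolyX; rewrite (_ : (fun x => _) = (fun x => 1 + (- 1) * p x ^+ n.*2)).
    apply: trigpolyD; first exact: trigpoly_cst.
    by apply: trigpolyZ; exact: trigpolyX.
  by apply/funext => x; rewrite mulN1r.
- exact: threshold_itv.
- rewrite indicE.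
  have -> : (a < tnth x j) = (p x < 2^-1).
    have /andP[x0 x1] := cx j.
    have pi0 := pi_gt0 R.
    rewrite /p gtrDl pmulr_rlt0// subr_lt0 ltr_cos ?in_itv/=; first by rewrite ltr_pM2l.
      by rewrite mulr_ge0 ?(ltW pi0)//= ler_piMr// ltW.
    by rewrite mulr_ge0 ?(ltW pi0)//= ler_piMr// ltW.
  exact: cvg_threshold.
Qed.

(** The sigma-algebra on tuples is generated by the coordinate preimages of Borel sets, and the
    Borel sets are generated by open rays, so [approximable_ray] suffices. *)
Lemma measurable_sub_approximable (A : set X) : measurable A ->
  <<s boundedly_approximable >> A.
Proof.
apply: smallest_sub; first exact: smallest_sigma_algebra.
apply: (big_ind (fun B : set (set X) => B `<=` <<s boundedly_approximable >>)).
- exact: sub0set.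
- by move=> B C hB hC D [/hB|/hC].
move=> j _.
have -> : (@measurable _ RT) = (@RGenOInfty.G R).-sigma.-measurable.
  exact: RGenOInfty.measurableE.
rewrite -(@g_sigma_preimageE X RT setT).
apply: sub_smallest2r; first exact: smallest_sigma_algebra.
move=> _ [B [a ->] <-]; rewrite setTI.
exact: (approximable_ray j a).
Qed.

Definition L2_approximable f := measurable_fun cube f /\
  forall e : R, 0 < e -> exists p, trigpoly p /\
    (\int[mu]_(x in cube) ((f x - p x) ^+ 2)%:E < e%:E)%E.

Let mcube := @measurable_cube R d.

Lemma measurable_sqrB f g : measurable_fun cube f -> measurable_fun cube g ->
  measurable_fun cube (fun x => ((f x - g x) ^+ 2)%:E).
Proof.
move=> mf mg; apply/measurable_EFinP; apply: measurable_funX.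
exact: measurable_funB.
Qed.

Lemma measurable_trigpoly_cube p : trigpoly p -> measurable_fun cube p.
Proof. by move=> tp; apply: measurable_funTS; exact: measurable_trigpoly. Qed.

(** From (f + g)^2 + (f - g)^2 = 2 f^2 + 2 g^2. It plays the part of the triangle inequality for
    squared norms; its factor 2 explains the error budgets e/4 below. *)
Lemma le_integral_sqrD f g : measurable_fun cube f -> measurable_fun cube g ->
  (\int[mu]_(x in cube) ((f x + g x) ^+ 2)%:E <=
   2%:E * \int[mu]_(x in cube) (f x ^+ 2)%:E +
   2%:E * \int[mu]_(x in cube) (g x ^+ 2)%:E)%E.
Proof.
move=> mf mg.
have m2 (h : X -> R) : measurable_fun cube h -> measurable_fun cube (fun x => (h x ^+ 2)%:E).
  by move=> mh; apply/measurable_EFinP; exact: measurable_funX.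
rewrite -ge0_integralZl//; [|exact: m2|by move=> x _; rewrite lee_fin sqr_ge0].
rewrite -ge0_integralZl//; [|exact: m2|by move=> x _; rewrite lee_fin sqr_ge0].
rewrite -ge0_integralD//.
- apply: ge0_le_integral => //.
  + by move=> x _; rewrite lee_fin sqr_ge0.
  + by apply: m2; exact: measurable_funD.
  + by apply: emeasurable_funD; apply: measurable_funeM; exact: m2.
  + move=> x _; rewrite -!EFinM -EFinD lee_fin.
    rewrite -subr_ge0 (_ : _ - _ = (f x - g x) ^+ 2) ?sqr_ge0//; by ring.
- by move=> x _; rewrite -EFinM lee_fin mulr_ge0// sqr_ge0.
- by apply: measurable_funeM; exact: m2.
- by move=> x _; rewrite -EFinM lee_fin mulr_ge0// sqr_ge0.
- by apply: measurable_funeM; exact: m2.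
Qed.

Lemma L2_approximable_closed f : measurable_fun cube f ->
  (forall e : R, 0 < e -> exists g, L2_approximable g /\
    (\int[mu]_(x in cube) ((f x - g x) ^+ 2)%:E < e%:E)%E) ->
  L2_approximable f.
Proof.
move=> mf H; split => // e e0.
have e4 : 0 < e / 4 by rewrite divr_gt0.
have [g [[mg Hg] fg]] := H _ e4; have [p [tp gp]] := Hg _ e4.
exists p; split => //.
have mp := measurable_trigpoly_cube tp.
have -> : (fun x => ((f x - p x) ^+ 2)%:E) =
    (fun x => (((f x - g x) + (g x - p x)) ^+ 2)%:E).
  by apply/funext => x; congr (_ ^+ 2)%:E; ring.
have := le_integral_sqrD (measurable_funB mf mg) (measurable_funB mg mp).
move/le_lt_trans; apply.
rewrite (_ : e%:E = 2%:E * (e / 4)%:E + 2%:E * (e / 4)%:E)%E.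
  by apply: lteD; rewrite lte_pmul2l.
by rewrite -!EFinM -EFinD; congr EFin; field.
Qed.

Lemma L2_approximableD f g : L2_approximable f -> L2_approximable g ->
  L2_approximable (fun x => f x + g x).
Proof.
move=> [mf Hf] [mg Hg]; split; first exact: measurable_funD.
move=> e e0; have e4 : 0 < e / 4 by rewrite divr_gt0.
have [p [tp fp]] := Hf _ e4; have [q [tq gq]] := Hg _ e4.
exists (fun x => p x + q x); split; first exact: trigpolyD.
have mp := measurable_trigpoly_cube tp; have mq := measurable_trigpoly_cube tq.
have -> : (fun x => ((f x + g x - (p x + q x)) ^+ 2)%:E) =
    (fun x => (((f x - p x) + (g x - q x)) ^+ 2)%:E).
  by apply/funext => x; congr (_ ^+ 2)%:E; ring.
have := le_integral_sqrD (measurable_funB mf mp) (measurable_funB mg mq).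
move/le_lt_trans; apply.
rewrite (_ : e%:E = 2%:E * (e / 4)%:E + 2%:E * (e / 4)%:E)%E.
  by apply: lteD; rewrite lte_pmul2l.
by rewrite -!EFinM -EFinD; congr EFin; field.
Qed.

Lemma trigpoly_L2_approximable p : trigpoly p -> L2_approximable p.
Proof.
move=> tp; split; first exact: measurable_trigpoly_cube.
move=> e e0; exists p; split => //.
by rewrite integral0_eq ?lte_fin// => x _; rewrite subrr expr0n.
Qed.

Lemma L2_approximableZ a f : L2_approximable f -> L2_approximable (fun x => a * f x).
Proof.
move=> [mf Hf]; split; first exact: measurable_funM.
move=> e e0; have [->|a0] := eqVneq a 0.
  exists (fun=> 0); split; first exact: trigpoly_cst.
  by rewrite integral0_eq ?lte_fin// => x _; rewrite mul0r subrr expr0n.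
have a2 : 0 < a ^+ 2 by rewrite exprn_even_gt0.
have [p [tp fp]] := Hf _ (divr_gt0 e0 a2).
exists (fun x => a * p x); split; first exact: trigpolyZ.
have mp := measurable_trigpoly_cube tp.
rewrite (eq_integral (fun x => (a ^+ 2)%:E * ((f x - p x) ^+ 2)%:E)%E); last first.
  by move=> x _; rewrite -EFinM -exprMn mulrBr.
rewrite ge0_integralZl//.
- rewrite (_ : e%:E = (a ^+ 2)%:E * (e / a ^+ 2)%:E)%E; first by rewrite lte_pmul2l.
  by rewrite -EFinM mulrC divfK// gt_eqF.
- exact: measurable_sqrB.
- by move=> x _; rewrite lee_fin sqr_ge0.
- by rewrite lee_fin ltW.
Qed.

Lemma L2_approximable_sum (I : Type) (s : seq I) (h : I -> X -> R) :
  (forall i, L2_approximable (h i)) -> L2_approximable (fun x => \sum_(i <- s) h i x).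
Proof.
move=> hh; elim: s => [|i s IH].
  by under eq_fun do rewrite big_nil; apply: trigpoly_L2_approximable; exact: trigpoly_cst.
by under eq_fun do rewrite big_cons; exact: L2_approximableD.
Qed.

Lemma L2_approximable_dominated (h : nat -> X -> R) f (G : X -> R) :
  (forall n, L2_approximable (h n)) -> measurable_fun cube f ->
  mu.-integrable cube (EFin \o G) ->
  (forall n x, cube x -> (h n x - f x) ^+ 2 <= G x) ->
  (forall x, cube x -> h ^~ x @ \oo --> f x) ->
  L2_approximable f.
Proof.
move=> Lh mf iG hG hf; apply: L2_approximable_closed => // e e0.
have mh n : measurable_fun cube (h n) by case: (Lh n).
have hyp1 : {ae mu, forall x, cube x ->
    (fun n => ((h n x - f x) ^+ 2)%:E) @ \oo --> (0%R%:E : \bar R)}.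
  apply: aeW => x cx; apply: cvg_EFin; first exact: nearW.
  rewrite (_ : 0 = (f x - f x) ^+ 2); last by rewrite subrr expr0n.
  rewrite (_ : fine \o _ = (fun n => (h n x - f x) * (h n x - f x)))//.
  by apply: cvgM; (apply: cvgB; [exact: hf|exact: cvg_cst]).
have hyp2 : {ae mu, forall x n, cube x -> (`|((h n x - f x) ^+ 2)%:E| <= (EFin \o G) x)%E}.
  by apply: aeW => x n cx /=; rewrite lee_fin ger0_norm ?sqr_ge0// hG.
have [_ cv _] := @dominated_convergence _ _ _ mu cube mcube
  (fun n x => ((h n x - f x) ^+ 2)%:E) (fun=> 0%E) (EFin \o G)
  (fun n => measurable_sqrB (mh n) mf) (measurable_cst _) hyp1 iG hyp2.
have nb : nbhs (0%E : \bar R) [set y | (y < e%:E)%E].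
  apply: open_nbhs_nbhs; split; first exact: open_ereal_lt_ereal.
  by rewrite /= lte_fin.
have [N _ /(_ N (leqnn N)) /= HN] := cv _ nb; exists (h N); split => //.
apply: le_lt_trans HN; rewrite le_eqVlt; apply/orP; left; apply/eqP.
apply: eq_integral => x _; rewrite subr0 ger0_norm ?sqr_ge0//.
by rewrite -sqrrN opprB.
Qed.

End Density.

(** * Density in L2 and orthonormality of the cosine basis *)

Section Completeness.
Context {R : realType} {d : nat}.
Local Notation RT := (measurableTypeR R).
Local Notation K := {ffun 'I_d -> int}.
Local Notation X := (d.-tuple RT).
Local Notation mu := (@lebesgue_tuple R d).
Local Notation cube := (@cube R d).
Implicit Types (k l : K) (p q f g : X -> R).
Let mcube := @measurable_cube R d.

Lemma integrable_cube_cst (c : R) : mu.-integrable cube (EFin \o (fun=> c)).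
Proof.
apply: measurable_bounded_integrable => //.
  by rewrite [ltLHS]lebesgue_tuple_cube ltry.
by apply: (@bounded_on _ _ _ _ `|c|).
Qed.

(** Dynkin's lemma: the measurable sets with approximable indicator form a lambda-system (proper
    differences by linearity, increasing unions by dominated convergence) that contains the
    pi-system of [boundedly_approximable] sets. *)
Lemma L2_approximable_indic (A : set X) : measurable A ->
  L2_approximable (\1_A : X -> R).
Proof.
have indic_sqrB (B C : set X) x : ((\1_B x - \1_C x) ^+ 2 : R) <= 1.
  rewrite !indicE; case: (x \in B); case: (x \in C);
    by rewrite ?subrr ?subr0 ?sub0r ?sqrrN ?expr1n ?expr0n//= ler01.
move=> /measurable_sub_approximable.
suff: <<s @boundedly_approximable R d >> `<=`
    [set A | measurable A /\ L2_approximable (\1_A : X -> R)].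
  by move=> /[apply] -[].
apply: (lambda_system_subset (@approximableI R d)) => //.
  split => //.
  - split=> //; rewrite indicT.
    by apply: trigpoly_L2_approximable; exact: trigpoly_cst.
  - move=> C B BC [mC LC] [mB LB]; split; first exact: measurableD.
    have -> : \1_(C `\` B) = (fun x => \1_C x + (- 1) * \1_B x) :> (X -> R).
      apply/funext => x; rewrite !indicE in_setD mulN1r.
      have [xB|xB] := boolP (x \in B); last by rewrite andbT subr0.
      by rewrite andbF (_ : x \in C) ?subrr// inE; apply: BC; rewrite inE in xB.
    by apply: L2_approximableD => //; exact: L2_approximableZ.
  - move=> F ndF HF; split; first by apply: bigcup_measurable => i _; case: (HF i).
    apply: (@L2_approximable_dominated _ _ (fun n => \1_(F n)) _ (fun=> 1)).
    + by move=> n; case: (HF n).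
    + apply: measurable_funTS; apply: measurable_indic.
      by apply: bigcup_measurable => i _; case: (HF i).
    + exact: integrable_cube_cst.
    + by move=> n x _; exact: indic_sqrB.
    + move=> x _; have [[N _ FN]|nF] := pselect ((\bigcup_i F i) x).
        apply: cvg_near_cst; near=> n.
        have Nn : (N <= n)%N by near: n; exact: nbhs_infty_ge.
        have Fnx : F n x by have /subsetPset := ndF _ _ Nn; exact.
        have Ux : (\bigcup_i F i) x by exists N.
        by rewrite !indicE !mem_set.
      apply: cvg_near_cst; apply: nearW => n.
      by rewrite !indicE !memNset// => Fx; apply: nF; exists n.
move=> {}A [mA [s [ts s01 sA]]]; split => //.
apply: (@L2_approximable_dominated _ _ s _ (fun=> 1)).
- by move=> n; exact: trigpoly_L2_approximable.
- by apply: measurable_funTS; exact: measurable_indic.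
- exact: integrable_cube_cst.
- move=> n x cx; have /andP[s0 s1] := s01 n x cx; rewrite indicE.
  rewrite -[X in X <= _]real_normK ?num_real// expr_le1//.
  by case: (x \in A); rewrite ?mulr1n ?mulr0n ler_norml; apply/andP; split; lra.
- by move=> x cx; exact: sA.
Unshelve. all: by end_near. Qed.

Import HBNNSimple.

Lemma L2_approximable_nnsfun (h : {nnsfun X >-> R}) : L2_approximable h.
Proof.
have -> : (h : X -> R) =
    (fun x => \sum_(y <- finmap.enum_fset (fset_set (range h))) y * \1_(h @^-1` [set y]) x).
  by apply/funext => x; rewrite fimfunE fsbig_finite.
apply: L2_approximable_sum => y; apply: L2_approximableZ.
exact: L2_approximable_indic.
Qed.

(** Simple functions increasing to f satisfy 0 <= h_n <= f on the cube, so f^2 dominates (h_n -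
    f)^2. *)
Lemma L2_approximable_ge0 f : measurable_fun cube f -> (forall x, cube x -> 0 <= f x) ->
  mu.-integrable cube (EFin \o (fun x => f x ^+ 2)) -> L2_approximable f.
Proof.
move=> mf f0 if2.
have mEf : measurable_fun cube (EFin \o f) by exact/measurable_EFinP.
have Ef0 x : cube x -> (0 <= (EFin \o f) x)%E by move=> /f0; rewrite lee_fin.
pose h := nnsfun_approx mcube mEf.
have cv x (cx : cube x) : (fun n => h n x) @ \oo --> f x.
  have := cvg_nnsfun_approx mcube mEf Ef0 cx.
  by move=> /fine_cvgP[].
apply: (@L2_approximable_dominated _ _ h _ (fun x => f x ^+ 2)) => //.
- by move=> n; exact: L2_approximable_nnsfun.
- move=> n x cx; have h0 : 0 <= h n x by [].
  have hf : h n x <= f x.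
    by rewrite /h nnsfun_approxE -lee_fin; exact: (le_approx n Ef0 cx).
  rewrite -sqrrN opprB ler_sqr ?nnegrE ?subr_ge0 ?f0//.
  by rewrite gerBl.
Qed.

Lemma L2_approximable_sqr_integrable f : measurable_fun cube f ->
  mu.-integrable cube (EFin \o (fun x => f x ^+ 2)) -> L2_approximable f.
Proof.
move=> mf if2.
have le_sqr (g : X -> R) : measurable_fun cube g -> (forall x, `|g x| <= `|f x|) ->
    mu.-integrable cube (EFin \o (fun x => g x ^+ 2)).
  move=> mg gf; apply: le_integrable if2 => //.
    by apply/measurable_EFinP; exact: measurable_funX.
  move=> x _ /=; rewrite lee_fin !normrX lerXn2r ?nnegrE//.
have -> : f = (fun x => f^\+ x + (-1) * f^\- x).
  by apply/funext => x; rewrite mulN1r -[in LHS](funrposBneg f).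
apply: L2_approximableD; last apply: L2_approximableZ.
- apply: L2_approximable_ge0.
  + exact: measurable_funrpos.
  + by move=> x _; exact: funrpos_ge0.
  + apply: le_sqr; first exact: measurable_funrpos.
    move=> x; rewrite ger0_norm ?funrpos_ge0// /funrpos ge_max ler_norm normr_ge0//.
- apply: L2_approximable_ge0.
  + exact: measurable_funrneg.
  + by move=> x _; exact: funrneg_ge0.
  + apply: le_sqr; first exact: measurable_funrneg.
    move=> x; rewrite ger0_norm ?funrneg_ge0// /funrneg ge_max -normrN ler_norm normr_ge0//.
Qed.

Lemma Rintegral_phi_phi k l : Zplus k -> Zplus l ->
  \int[mu]_(x in cube) (phi k x * phi l x) = (k == l)%:R :> R.
Proof.
move=> k0 l0.
pose g (j : 'I_d) (x : RT) : R := cos (pi * (k j)%:~R * x) * cos (pi * (l j)%:~R * x).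
have mg j : measurable_fun setT (g j) by apply: measurable_funM; exact: measurable_cosZ.
have g1 j x : `|g j x| <= 1 by rewrite normrM mulr_ile1 ?norm_cos_le1.
have ig : mu.-integrable cube (EFin \o (fun x => \prod_(j < d) g j (tnth x j))).
  apply: measurable_bounded_integrable => //.
  - by rewrite [ltLHS]lebesgue_tuple_cube ltry.
  - by apply: measurable_funTS; exact: measurable_tuple_prod.
  - apply: (@bounded_on _ _ _ _ 1) => x _.
    by rewrite normr_prod; apply: prodr_ile1 => j; rewrite normr_ge0 g1.
rewrite (@eq_Rintegral _ _ _ _ _ (fun x => Num.sqrt 2 ^+ (nnz k + nnz l) *
    \prod_(j < d) g j (tnth x j))); last first.
  by move=> x _; rewrite /phi mulrACA -exprD -big_split.
rewrite RintegralZl// Rintegral_cube_prod//.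
under eq_bigr do rewrite Rintegral_cos_cos.
(* On the diagonal a coordinate with k_j nonzero integrates to 1/2, which cancels one factor
   sqrt(2)^2 = 2 of the normalisation; a zero coordinate integrates to 1. *)
have [<-|/eqP kl] := eqVneq k l.
  rewrite exprD -expr2 exprAC sqr_sqrtr// /nnz -prodr_const.
  rewrite big_mkcond -big_split /= big1// => j _.
  rewrite inE subrr eqxx; have [->|kj0] := eqVneq (k j) 0.
    by rewrite addr0 eqxx /=; field.
  have -> : (k j + k j == 0) = false by lia.
  by rewrite /=; field.
have [j kj] : exists j, k j != l j.
  apply/existsP; apply: contra_notT kl => /existsPn H.
  by apply/ffunP => j; have := H j; rewrite negbK => /eqP.
(* The factor at [j] could survive only if k_j = - l_j, impossible for distinct nonnegative
   integers. *)
rewrite (bigD1 j)//= subr_eq0 (negbTE kj) addr_eq0.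
case: eqP => [H|_]; last by rewrite addr0 mulr0 mul0r mulr0.
have := k0 j; have := l0 j; move: kj; rewrite H; lia.
Qed.

End Completeness.

(** * Parseval's identity *)

Section Parseval.
Context {R : realType} {d : nat}.
Local Notation RT := (measurableTypeR R).
Local Notation K := {ffun 'I_d -> int}.
Local Notation X := (d.-tuple RT).
Local Notation mu := (@lebesgue_tuple R d).
Local Notation cube := (@cube R d).
Implicit Types (k l : K) (f g : X -> R).
Let mcube := @measurable_cube R d.

Lemma absv_ge0 k : Zplus (absv k).
Proof. by move=> j; rewrite ffunE. Qed.

Lemma nnz_absv k : nnz (absv k) = nnz k.
Proof. by apply: eq_card => j; rewrite !inE ffunE normr_eq0. Qed.

Lemma cosmono_absv k (x : X) : cosmono (absv k) x = cosmono k x.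
Proof.
apply: eq_bigr => j _; rewrite ffunE.
by case: (ger0P (k j)) => // _; rewrite mulrNz mulrN mulNr cosN.
Qed.

Lemma big_partition_undup (I J : eqType) (V : nmodType) (t : seq I) (h : I -> J) (F : I -> V) :
  \sum_(i <- t) F i = \sum_(j <- undup (map h t)) \sum_(i <- t | h i == j) F i.
Proof.
under [RHS]eq_bigr do rewrite big_mkcond.
rewrite exchange_big /= big_seq [RHS]big_seq; apply: eq_bigr => i it.
rewrite (bigD1_seq (h i)) ?undup_uniq ?mem_undup ?map_f//= eqxx big1 ?addr0//.
by move=> j /negbTE; rewrite eq_sym => ->.
Qed.

(** Cosine is even, so frequencies with the same absolute values give the same function; collecting
    them leaves distinct indices in Z_+^d, where orthonormality applies. *)
Lemma trigpoly_phi (p : X -> R) : trigpoly p -> exists (s : seq K) (b : K -> R),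
  [/\ uniq s, forall k, k \in s -> Zplus k &
      p = fun x => \sum_(k <- s) b k * phi k x].
Proof.
move=> [t ->]; exists (undup [seq absv c.2 | c <- t]).
exists (fun k => \sum_(c <- t | absv c.2 == k) c.1 / Num.sqrt 2 ^+ nnz c.2); split.
- exact: undup_uniq.
- by move=> k; rewrite mem_undup => /mapP[c _ ->]; exact: absv_ge0.
- apply/funext => x; rewrite (big_partition_undup _ (fun c => absv c.2)).
  apply: eq_bigr => k _; rewrite big_distrl /=; apply: eq_bigr => c /eqP <-.
  by rewrite phiE nnz_absv cosmono_absv mulrA divfK.
Qed.

Definition sqr_integrable f :=
  measurable_fun cube f /\ mu.-integrable cube (EFin \o (fun x => f x ^+ 2)).

Lemma mul_le_sqrD (a b : R) : a * b <= a ^+ 2 + b ^+ 2.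
Proof.
by have := sqr_ge0 (a - b); have := sqr_ge0 a; have := sqr_ge0 b; nra.
Qed.

Lemma sqr_integrableM f g : sqr_integrable f -> sqr_integrable g ->
  mu.-integrable cube (EFin \o (fun x => f x * g x)).
Proof.
move=> [mf if2] [mg ig2].
apply: le_integrable (integrableD mcube if2 ig2) => //.
  by apply/measurable_EFinP; exact: measurable_funM.
move=> x _ /=; rewrite lee_fin [leRHS]ger0_norm ?addr_ge0 ?sqr_ge0//.
rewrite normrM -(real_normK (num_real (f x))) -(real_normK (num_real (g x))).
exact: mul_le_sqrD.
Qed.

Lemma sqr_integrable_bounded f (B : R) : measurable_fun cube f ->
  (forall x, `|f x| <= B) -> sqr_integrable f.
Proof.
move=> mf fB; split => //; apply: measurable_bounded_integrable => //.
- by rewrite [ltLHS]lebesgue_tuple_cube ltry.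
- exact: measurable_funX.
- apply: (@bounded_on _ _ _ _ (B ^+ 2)) => x _.
  by rewrite normrX lerXn2r ?nnegrE// (le_trans _ (fB x)).
Qed.

Lemma sqr_integrable_phi k : sqr_integrable (phi k).
Proof.
apply: (@sqr_integrable_bounded _ (Num.sqrt 2 ^+ nnz k)).
  apply: measurable_funTS; apply: measurable_funM => //.
  exact: measurable_cosmono.
move=> x; rewrite phiE normrM ger0_norm ?exprn_ge0//.
by rewrite ler_piMr ?exprn_ge0// norm_cosmono.
Qed.

Lemma sqr_integrableZ a f : sqr_integrable f -> sqr_integrable (fun x => a * f x).
Proof.
move=> [mf if2]; split; first exact: measurable_funM.
apply: eq_integrable (integrableZl mcube (a ^+ 2) if2) => // x _ /=.
by rewrite exprMn EFinM.
Qed.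

Lemma sqr_integrableD f g : sqr_integrable f -> sqr_integrable g ->
  sqr_integrable (fun x => f x + g x).
Proof.
move=> Lf Lg; have [mf if2] := Lf; have [mg ig2] := Lg.
split; first exact: measurable_funD.
have ifg := integrableZl mcube 2 (sqr_integrableM Lf Lg).
have := integrableD mcube (integrableD mcube if2 ig2) ifg.
apply: eq_integrable => // x _ /=.
by rewrite -EFinM -!EFinD; congr EFin; ring.
Qed.

Lemma sqr_integrable_sum (I : Type) (s : seq I) (h : I -> X -> R) :
  (forall i, sqr_integrable (h i)) -> sqr_integrable (fun x => \sum_(i <- s) h i x).
Proof.
move=> hh; elim: s => [|i s IH].
  under eq_fun do rewrite big_nil.
  by apply: (@sqr_integrable_bounded _ 0) => // x; rewrite normr0.
by under eq_fun do rewrite big_cons; exact: sqr_integrableD.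
Qed.

Definition cosine_coef f k : R := \int[mu]_(x in cube) (f x * phi k x).

Lemma cosine_coefD f g k : sqr_integrable f -> sqr_integrable g ->
  cosine_coef (fun x => f x + g x) k = cosine_coef f k + cosine_coef g k.
Proof.
move=> Lf Lg; have Lk := sqr_integrable_phi k.
rewrite /cosine_coef -RintegralD//; [|exact: sqr_integrableM|exact: sqr_integrableM].
by apply: eq_Rintegral => x _; rewrite mulrDl.
Qed.

Lemma cosine_coefZ a f k : sqr_integrable f ->
  cosine_coef (fun x => a * f x) k = a * cosine_coef f k.
Proof.
move=> Lf; have Lk := sqr_integrable_phi k.
rewrite /cosine_coef -RintegralZl//; last exact: sqr_integrableM.
by apply: eq_Rintegral => x _; rewrite mulrA.
Qed.

Lemma cosine_coef_sum (s : seq K) (b : K -> R) k : Zplus k -> uniq s ->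
  (forall l, l \in s -> Zplus l) ->
  cosine_coef (fun x => \sum_(l <- s) b l * phi l x) k = if k \in s then b k else 0.
Proof.
move=> k0; elim: s => [|l s IH] /=.
  move=> _ _; rewrite /cosine_coef (@eq_Rintegral _ _ _ _ _ (fun=> 0)).
    by rewrite Rintegral_cst// mul0r.
  by move=> x _; rewrite big_nil mul0r.
move=> /andP[ls us] Zs.
have -> : (fun x => \sum_(i <- l :: s) b i * phi i x) =
   (fun x : X => b l * phi l x + \sum_(i <- s) b i * phi i x).
  by apply/funext => x; rewrite big_cons.
have LS : sqr_integrable (fun x => \sum_(i <- s) b i * phi i x).
  by apply: sqr_integrable_sum => i; apply: sqr_integrableZ; exact: sqr_integrable_phi.
have Ll := sqr_integrable_phi l.
rewrite (cosine_coefD k (sqr_integrableZ (b l) Ll) LS) (cosine_coefZ (b l) k Ll).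
rewrite IH//; last by move=> i si; apply: Zs; rewrite inE si orbT.
rewrite {1}/cosine_coef Rintegral_phi_phi//; last by apply: Zs; rewrite inE eqxx.
rewrite inE eq_sym; move: ls; have [->|_] := eqVneq k l => ls; last by rewrite mulr0 add0r.
by rewrite mulr1 (negbTE ls) addr0.
Qed.

(** Completing the square, one frequency at a time. With b the coefficients of f it gives Bessel's
    inequality; with arbitrary b it shows that these coefficients minimise the error. *)
Lemma Rintegral_sqr_subsum f (s : seq K) (b : K -> R) : sqr_integrable f -> uniq s ->
  (forall l, l \in s -> Zplus l) ->
  \int[mu]_(x in cube) ((f x - \sum_(l <- s) b l * phi l x) ^+ 2) =
  \int[mu]_(x in cube) (f x ^+ 2) - \sum_(l <- s) cosine_coef f l ^+ 2 +
  \sum_(l <- s) (b l - cosine_coef f l) ^+ 2.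
Proof.
move=> Lf; elim: s => [|l s IH] /=.
  move=> _ _; rewrite !big_nil subr0 addr0.
  by apply: eq_Rintegral => x _; rewrite big_nil subr0.
move=> /andP[ls us] Zs.
have Zs' k : k \in s -> Zplus k by move=> ks; apply: Zs; rewrite inE ks orbT.
have Zl : Zplus l by apply: Zs; rewrite inE eqxx.
pose g x := f x + (-1) * \sum_(i <- s) b i * phi i x.
have LS : sqr_integrable (fun x => \sum_(i <- s) b i * phi i x).
  by apply: sqr_integrable_sum => i; apply: sqr_integrableZ; exact: sqr_integrable_phi.
have Lg : sqr_integrable g by apply: sqr_integrableD => //; exact: sqr_integrableZ.
have Ll := sqr_integrable_phi l.
(* Since [l] is not in [s], orthogonality makes the part already subtracted invisible to the
   coefficient at [l]. *)
have gl : cosine_coef g l = cosine_coef f l.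
  rewrite cosine_coefD ?cosine_coefZ ?cosine_coef_sum ?(negbTE ls) ?mulr0 ?addr0//.
  exact: sqr_integrableZ.
transitivity (\int[mu]_(x in cube)
   (g x ^+ 2 + ((- 2 * b l) * (g x * phi l x) + b l ^+ 2 * (phi l x * phi l x)))).
  by apply: eq_Rintegral => x _; rewrite big_cons /g; ring.
have i1 := sqr_integrableM Lg Ll; have i2 := sqr_integrableM Ll Ll.
have i3 : mu.-integrable cube (EFin \o (fun x => - 2 * b l * (g x * phi l x))).
  by apply: eq_integrable (integrableZl mcube (- 2 * b l) i1).
have i4 : mu.-integrable cube (EFin \o (fun x => b l ^+ 2 * (phi l x * phi l x))).
  by apply: eq_integrable (integrableZl mcube (b l ^+ 2) i2).
rewrite RintegralD//; [|by case: Lg|]; last first.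
  exact: (integrableD mcube i3 i4).
rewrite RintegralD// RintegralZl// RintegralZl//.
rewrite Rintegral_phi_phi// eqxx -/(cosine_coef g l) gl.
rewrite (_ : \int[mu]_(x in cube) (g x ^+ 2) =
    \int[mu]_(x in cube) ((f x - \sum_(l <- s) b l * phi l x) ^+ 2)); last first.
  by apply: eq_Rintegral => x _; rewrite /g mulN1r.
by rewrite IH// !big_cons mulr1; ring.
Qed.

Lemma parseval_real f : sqr_integrable f ->
  (\int[mu]_(x in cube) (f x ^+ 2)%:E)%E =
  (\esum_(k in Zplus (d := d)) (cosine_coef f k ^+ 2)%:E)%E.
Proof.
move=> Lf; have [mf if2] := Lf.
have fin2 : (\int[mu]_(x in cube) (f x ^+ 2)%:E)%E =
    (\int[mu]_(x in cube) (f x ^+ 2))%:E.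
  by rewrite /Rintegral fineK//; exact: (integrable_fin_num mcube if2).
apply/eqP; rewrite eq_le; apply/andP; split; last first.
  (* Bessel's inequality, on each finite set of frequencies. *)
  apply: ge_ereal_sup => _ [A [finA AZ] <-].
  rewrite fsbig_finite//= sumEFin fin2 lee_fin.
  have Zs k : k \in finmap.enum_fset (fset_set A) -> Zplus k.
    by rewrite in_fset_set// inE => /AZ.
  have := Rintegral_sqr_subsum (cosine_coef f) Lf (finmap.fset_uniq (fset_set A)) Zs.
  rewrite [X in _ + X]big1 ?addr0; last by move=> i _; rewrite subrr expr0n.
  move=> H; rewrite -subr_ge0 -H.
  by apply: Rintegral_ge0 => x _; rewrite sqr_ge0.
(* Conversely, an approximating polynomial with squared error below [e] is no better than the
   Fourier sum over its own frequencies, so the coefficients there miss at most [e] of the squared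
   norm. *)
apply/lee_addgt0Pr => e e0.
have [_ /(_ _ e0) [p [tp]]] := L2_approximable_sqr_integrable mf if2.
have [s [b [us Zs ->]]] := trigpoly_phi tp => Hp.
have LS : sqr_integrable (fun x => \sum_(i <- s) b i * phi i x).
  by apply: sqr_integrable_sum => i; apply: sqr_integrableZ; exact: sqr_integrable_phi.
have [_ iD] : sqr_integrable (fun x => f x - \sum_(i <- s) b i * phi i x).
  rewrite (_ : (fun x => _) = (fun x => f x + (-1) * \sum_(i <- s) b i * phi i x)).
    by apply: sqr_integrableD => //; exact: sqr_integrableZ.
  by apply/funext => x; rewrite mulN1r.
have {}Hp : \int[mu]_(x in cube) ((f x - \sum_(l <- s) b l * phi l x) ^+ 2) < e.
  rewrite -lte_fin /Rintegral fineK//; exact: (integrable_fin_num mcube iD).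
rewrite (Rintegral_sqr_subsum b Lf us Zs) in Hp.
have Hs : (\sum_(l <- s) (cosine_coef f l ^+ 2)%:E <=
    \esum_(k in Zplus (d := d)) (cosine_coef f k ^+ 2)%:E)%E.
  apply: ereal_sup_ubound; exists [set` s].
    by split; [exact: finite_seq|move=> k /= /Zs].
  by rewrite -fsbig_seq.
rewrite fin2; apply: le_trans (leeD2r _ Hs).
rewrite sumEFin -EFinD lee_fin.
have : 0 <= \sum_(l <- s) (b l - cosine_coef f l) ^+ 2.
  by apply: sumr_ge0 => i _; rewrite sqr_ge0.
lra.
Qed.

End Parseval.

(** * Parseval's identity for complex-valued functions *)

Section ParsevalComplex.
Context {R : realType} {d : nat}.
Local Notation RT := (measurableTypeR R).
Local Notation K := {ffun 'I_d -> int}.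
Local Notation X := (d.-tuple RT).
Local Notation mu := (@lebesgue_tuple R d).
Local Notation cube := (@cube R d).
Implicit Types (k l : K) (f g : X -> R[i]).
Let mcube := @measurable_cube R d.

Lemma sqr_normcE (w : R[i]) : normc w ^+ 2 = complex.Re w ^+ 2 + complex.Im w ^+ 2.
Proof. by case: w => a b; rewrite sqr_sqrtr// addr_ge0// sqr_ge0. Qed.

Lemma fhatE f k : fhat f k =
  Complex (cosine_coef (fun x => complex.Re (f x)) k)
          (cosine_coef (fun x => complex.Im (f x)) k).
Proof.
congr Complex; apply: eq_Rintegral => x _; case: (f x) => a b /=.
  by rewrite mulr0 subr0.
by rewrite mulr0 add0r.
Qed.

Definition components_L2 f := sqr_integrable (fun x => complex.Re (f x)) /\
  sqr_integrable (fun x => complex.Im (f x)).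

Lemma in_L2_components f : in_L2 f -> components_L2 f.
Proof.
move=> [mr mi]; rewrite /L2normsq => fin.
have H (h : X -> R) : measurable_fun cube h ->
    (forall x, h x ^+ 2 <= normc (f x) ^+ 2) -> sqr_integrable h.
  move=> mh hf; split => //.
  apply/integrableP; split; first by apply/measurable_EFinP; exact: measurable_funX.
  apply: le_lt_trans fin; apply: ge0_le_integral => //.
  - apply: measurableT_comp => //; apply/measurable_EFinP; exact: measurable_funX.
  - apply/measurable_EFinP.
    rewrite (_ : (fun x => _) = (fun x => complex.Re (f x) ^+ 2 + complex.Im (f x) ^+ 2)).
      by apply: measurable_funD; exact: measurable_funX.
    by apply/funext => x; rewrite sqr_normcE.
  - by move=> x _ /=; rewrite lee_fin ger0_norm ?sqr_ge0.
by split; apply: H => // x; rewrite sqr_normcE ?lerDl ?lerDr sqr_ge0.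
Qed.

Lemma parseval f : components_L2 f ->
  L2normsq f = (\esum_(k in Zplus (d := d)) (normc (fhat f k) ^+ 2)%:E)%E.
Proof.
move=> [Lr Li]; have [mr ir] := Lr; have [mi ii] := Li.
transitivity (\int[mu]_(x in cube) (complex.Re (f x) ^+ 2)%:E +
    \int[mu]_(x in cube) (complex.Im (f x) ^+ 2)%:E)%E.
  rewrite -ge0_integralD//.
  - by apply: eq_integral => x _; rewrite sqr_normcE EFinD.
  - by move=> x _; rewrite lee_fin sqr_ge0.
  - by apply/measurable_EFinP; exact: measurable_funX.
  - by move=> x _; rewrite lee_fin sqr_ge0.
  - by apply/measurable_EFinP; exact: measurable_funX.
rewrite !parseval_real// -esumD.
- by apply: eq_esum => k _; rewrite fhatE sqr_normcE EFinD.
- by move=> k _; rewrite lee_fin sqr_ge0.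
- by move=> k _; rewrite lee_fin sqr_ge0.
Qed.

Lemma Re_sum (I : Type) (s : seq I) (F : I -> R[i]) :
  complex.Re (\sum_(i <- s) F i) = \sum_(i <- s) complex.Re (F i).
Proof.
elim: s => [|i s IH]; first by rewrite !big_nil.
by rewrite !big_cons -IH; case: (F i); case: (\sum_(j <- s) F j).
Qed.

Lemma Im_sum (I : Type) (s : seq I) (F : I -> R[i]) :
  complex.Im (\sum_(i <- s) F i) = \sum_(i <- s) complex.Im (F i).
Proof.
elim: s => [|i s IH]; first by rewrite !big_nil.
by rewrite !big_cons -IH; case: (F i); case: (\sum_(j <- s) F j).
Qed.

Lemma parseval_sub_sum f (s : seq K) (c : K -> R[i]) : in_L2 f -> uniq s ->
  (forall k, k \in s -> Zplus k) ->
  L2normsq (fun x => f x - \sum_(k <- s) c k * (phi k x)%:C%C) =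
  (\esum_(k in Zplus (d := d) `\` [set` s]) (normc (fhat f k) ^+ 2)%:E +
   \sum_(k <- s) (normc (fhat f k - c k) ^+ 2)%:E)%E.
Proof.
move=> /in_L2_components [Lr Li] us Zs.
set g := fun x => _.
have gr : (fun x => complex.Re (g x)) = (fun x => complex.Re (f x) +
    (-1) * \sum_(k <- s) complex.Re (c k) * phi k x).
  apply/funext => x; rewrite /g raddfB /= Re_sum mulN1r; congr (_ - _).
  by apply: eq_bigr => k _; case: (c k) => a b /=; rewrite mulr0 subr0.
have gi : (fun x => complex.Im (g x)) = (fun x => complex.Im (f x) +
    (-1) * \sum_(k <- s) complex.Im (c k) * phi k x).
  apply/funext => x; rewrite /g raddfB /= Im_sum mulN1r; congr (_ - _).
  by apply: eq_bigr => k _; case: (c k) => a b /=; rewrite mulr0 add0r.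
have LS (b : K -> R) : sqr_integrable (fun x : X => \sum_(k <- s) b k * phi k x).
  by apply: sqr_integrable_sum => i; apply: sqr_integrableZ; exact: sqr_integrable_phi.
(* This is all that distinguishes g from f, so Parseval for g splits into the untouched frequencies
   outside [s] and the corrected ones inside. *)
have ghat k : Zplus k -> fhat g k = fhat f k - (if k \in s then c k else 0).
  move=> Zk; rewrite !fhatE gr gi.
  rewrite !cosine_coefD//; [|exact: sqr_integrableZ|exact: sqr_integrableZ].
  rewrite !cosine_coefZ// !cosine_coef_sum// !mulN1r.
  case: (k \in s); last by rewrite !subr0.
  by case: (c k).
rewrite parseval; last first.
  by split; rewrite ?gr ?gi; apply: sqr_integrableD => //; exact: sqr_integrableZ.
rewrite (esumID [set` s]); last by move=> k _; rewrite lee_fin sqr_ge0.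
rewrite addeC; congr (_ + _)%E.
  rewrite -setDE; apply: eq_esum => k [Zk ks].
  by rewrite ghat// ifF ?subr0//; apply/negP.
rewrite (_ : _ `&` _ = [set` s]); last first.
  by apply/seteqP; split => [k [_ //]|k /= ks]; split => //; exact: Zs.
rewrite esum_fset; [|exact: finite_seq|by move=> k _; rewrite lee_fin sqr_ge0].
rewrite -fsbig_seq//.
rewrite big_seq [RHS]big_seq; apply: eq_bigr => k ks.
by rewrite ghat ?ks//; exact: Zs.
Qed.

End ParsevalComplex.

(** * Unconditional sums *)

Section UnconditionalSums.
Context {R : realType}.
Local Notation C := (R[i]).
#[local] Existing Instance summability.totally_filter.

(* Convergence of the net [csum_net], with duplicate-free sequences in place of
   finite sets of indices. *)
Definition has_csum (I : eqType) (a : I -> C) (s : C) := forall e : R, 0 < e ->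
  exists A : seq I, forall B : seq I, uniq B -> {subset A <= B} ->
    normc (\sum_(i <- B) a i - s) < e.

Lemma normC_normc (w : C) : `|w| = (normc w)%:C%C.
Proof. by []. Qed.

Lemma normc_ge0 (w : C) : 0 <= normc w.
Proof. by case: w => a b; exact: sqrtr_ge0. Qed.

Lemma normcR (a : R) : normc a%:C%C = `|a|.
Proof. by rewrite /= expr0n addr0 sqrtr_sqr. Qed.

Lemma ler_sum_subset (I : eqType) (F : I -> R) (B T : seq I) : (forall i, 0 <= F i) ->
  uniq B -> {subset B <= T} -> \sum_(i <- B) F i <= \sum_(i <- T) F i.
Proof.
move=> F0; elim: B T => [|i B IH] T /=.
  by move=> _ _; rewrite big_nil; apply: sumr_ge0.
move=> /andP[iB uB] BT.
have iT : i \in T by apply: BT; rewrite inE eqxx.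
rewrite (perm_big _ (perm_to_rem iT)) /= !big_cons lerD2l; apply: IH => // j jB.
have : j \in T by apply: BT; rewrite inE jB orbT.
rewrite (perm_mem (perm_to_rem iT)) inE => /orP[/eqP ji|//].
by rewrite -ji jB in iB.
Qed.

Lemma has_csum_cvg (I : choiceType) (D : set I) (a : I -> C) (s : C) :
  has_csum (fun i => if i \in D then a i else 0) s ->
  csum_net D a @ summability.totally --> (s : C^o).
Proof.
move=> H; apply/(@cvgrPdist_lt _ C^o) => e e0.
(* In the partial order of [R[i]], a positive [e] is real, so its real part serves as the
   tolerance. *)
have [er ei] : complex.Re e > 0 /\ complex.Im e = 0.
  by move: e0; case: e => x y; rewrite ltcE /= => /andP[/eqP -> ->].
have [A HA] := H _ er.
exists (finmap.seq_fset tt A) => // B AB.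
have {}AB : finmap.fsubset (finmap.seq_fset tt A) B := AB.
rewrite /= distrC normC_normc ltcE /= ei eqxx /=.
rewrite /csum_net /summability.partial_sum.
rewrite -(finmap.big_seq_fsetE _ B xpredT (fun i => if i \in D then a i else 0)).
apply: HA; first exact: finmap.fset_uniq.
by move=> i iA; apply: (finmap.fsubsetP AB); rewrite (finmap.seq_fsetE tt A).
Qed.

Lemma has_csum_csummable (I : choiceType) (D : set I) (a : I -> C) (s : C) :
  has_csum (fun i => if i \in D then a i else 0) s -> csummable D a.
Proof. by move=> /has_csum_cvg /cvgP. Qed.

Lemma has_csumE (I : choiceType) (D : set I) (a : I -> C) (s : C) :
  has_csum (fun i => if i \in D then a i else 0) s -> csum D a = s.
Proof.
by move=> /has_csum_cvg; apply: cvg_lim; exact: norm_hausdorff.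
Qed.

Section Theory.
Context {I : eqType}.
Implicit Types (a b : I -> C).

Lemma eq_has_csum a b s : a =1 b -> has_csum a s -> has_csum b s.
Proof. by move=> /funext ->. Qed.

Lemma has_csumD a b s t : has_csum a s -> has_csum b t ->
  has_csum (fun i => a i + b i) (s + t).
Proof.
move=> ha hb e e0; have e2 : 0 < e / 2 by rewrite divr_gt0.
have [A HA] := ha _ e2; have [B HB] := hb _ e2.
exists (A ++ B) => T uT ABT.
rewrite big_split /= opprD addrACA (le_lt_trans (le_normcD _ _))//.
rewrite [ltRHS]splitr ltrD//.
  by apply: HA => // i iA; apply: ABT; rewrite mem_cat iA.
by apply: HB => // i iB; apply: ABT; rewrite mem_cat iB orbT.
Qed.

Lemma has_csum0 : has_csum (fun _ : I => 0) 0.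
Proof. by move=> e e0; exists [::] => B _ _; rewrite big1// subrr normcR normr0. Qed.

Lemma has_csumZ c a s : has_csum a s -> has_csum (fun i => c * a i) (c * s).
Proof.
move=> ha e e0; have c0 : 0 < normc c + 1 by rewrite ltr_wpDl// normc_ge0.
have [A HA] := ha _ (divr_gt0 e0 c0); exists A => B uB AB.
rewrite -big_distrr /= -mulrBr ComplexField.Normc.normcM.
have := HA _ uB AB; rewrite ltr_pdivlMr//; apply: le_lt_trans.
by rewrite mulrC ler_wpM2l ?normc_ge0// lerDl.
Qed.

Lemma has_csum_sum (J : Type) (r : seq J) (a : J -> I -> C) (s : J -> C) :
  (forall j, has_csum (a j) (s j)) ->
  has_csum (fun i => \sum_(j <- r) a j i) (\sum_(j <- r) s j).
Proof.
move=> ha; elim: r => [|j r IH].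
  by rewrite big_nil; apply: eq_has_csum has_csum0 => i; rewrite big_nil.
by rewrite big_cons; apply: eq_has_csum (has_csumD (ha j) IH) => i; rewrite big_cons.
Qed.

Lemma has_csum_pred1 (i0 : I) (c : C) : has_csum (fun i => if i == i0 then c else 0) c.
Proof.
move=> e e0; exists [:: i0] => B uB iB.
rewrite (bigD1_seq i0)//=; last by apply: iB; rewrite inE.
rewrite eqxx big1 ?addr0 ?subrr ?normcR ?normr0//.
by move=> i /negbTE ->.
Qed.

Lemma has_csum_unique a s t : has_csum a s -> has_csum a t -> s = t.
Proof.
move=> hs ht; apply/eqP; rewrite -subr_eq0 -(normr_eq0 (s - t)) normC_normc.
rewrite (_ : normc (s - t) = 0)//; apply/eqP; rewrite eq_le normc_ge0 andbT.
apply/ler_addgt0Pl => e e0; rewrite addr0.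
have e2 : 0 < e / 2 by rewrite divr_gt0.
have [A HA] := hs _ e2; have [B HB] := ht _ e2.
have uT := undup_uniq (A ++ B).
have {}HA := HA _ uT _; have {}HB := HB _ uT _.
set S := \sum_(i <- undup (A ++ B)) a i in HA HB.
have -> : s - t = - (S - s) + (S - t) by rewrite opprB addrA subrK.
apply: ltW; rewrite (le_lt_trans (le_normcD _ _))// normcN [ltRHS]splitr ltrD//.
  by apply: HA => i iA; rewrite mem_undup mem_cat iA.
by apply: HB => i iB; rewrite mem_undup mem_cat iB orbT.
Qed.

(** [F i] lists the fibre of [p] over [i]. Fibres are finite and disjoint, so concatenating those
    over a finite set of indices gives a duplicate-free list, one of the partial sums already
    controlled. *)
Lemma has_csum_group (J : eqType) (p : J -> I) (F : I -> seq J) (b : J -> C) s :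
  (forall i, uniq (F i)) -> (forall i j, j \in F i = (p j == i)) ->
  has_csum b s -> has_csum (fun i => \sum_(j <- F i) b j) s.
Proof.
move=> uF mF hb e e0; have [A HA] := hb _ e0.
exists (map p A) => B uB AB.
have -> : \sum_(i <- B) \sum_(j <- F i) b j = \sum_(j <- flatten (map F B)) b j.
  by rewrite big_flatten big_map.
apply: HA.
  elim: B uB {AB} => //= i B IH /andP[iB uB].
  rewrite cat_uniq uF IH// andbT /=; apply/hasPn => j /flatten_mapP[k kB].
  rewrite !mF => /eqP pjk; apply: contra iB => /eqP <-.
  by rewrite pjk.
move=> j jA; apply/flatten_mapP; exists (p j); last by rewrite mF.
by apply: AB; exact: map_f.
Qed.

Lemma has_csum_reindex (J : eqType) (p : J -> I) (q : I -> J) (b : J -> C) s :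
  cancel p q -> cancel q p -> has_csum b s -> has_csum (fun i => b (q i)) s.
Proof.
move=> pK qK hb.
have := @has_csum_group _ p (fun i => [:: q i]) b s _ _ hb.
move=> /(_ (fun=> isT)) H; apply: eq_has_csum (H _).
  by move=> i; rewrite big_seq1.
by move=> i j; rewrite inE; apply/eqP/eqP => [->|<-].
Qed.

Lemma ge0_has_csum (b : I -> R) (M : R) : (forall i, 0 <= b i) ->
  (forall B, uniq B -> \sum_(i <- B) b i <= M) ->
  exists s, has_csum (fun i => (b i)%:C%C) s.
Proof.
move=> b0 bM.
pose E := [set x : R | exists2 B : seq I, uniq B & x = \sum_(i <- B) b i].
have supE : has_sup E.
  split; first by exists 0; exists [::]; rewrite ?big_nil.
  by exists M => _ [B uB ->]; exact: bM.
exists (sup E)%:C%C => e e0.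
have [_ [A uA ->] HA] := sup_adherent e0 supE.
exists A => B uB AB.
rewrite -rmorph_sum -rmorphB normcR /=.
have BE : \sum_(i <- B) b i <= sup E.
  by apply: ub_le_sup; [exact: supE.2|exists B].
rewrite distrC ger0_norm ?subr_ge0//.
have : \sum_(i <- A) b i <= \sum_(i <- B) b i by exact: ler_sum_subset.
by move: HA; set x := \sum_(i <- A) _; set y := \sum_(i <- B) _ => *; lra.
Qed.

Lemma abs_has_csum (a : I -> C) (M : R) :
  (forall B, uniq B -> \sum_(i <- B) normc (a i) <= M) -> exists s, has_csum a s.
Proof.
move=> aM.
have real_case (b : I -> R) : (forall i, `|b i| <= normc (a i)) ->
    exists s, has_csum (fun i => (b i)%:C%C) s.
  move=> ba; have bM B : uniq B -> \sum_(i <- B) `|b i| <= M.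
    by move=> uB; apply: le_trans (aM _ uB); exact: ler_sum.
  have [s hs] := ge0_has_csum (fun i => normr_ge0 (b i)) bM.
  (* Both |b| and b + |b| are nonnegative with bounded partial sums, and [b] is their difference. *)
  have [||t ht] := @ge0_has_csum (fun i => b i + `|b i|) (M + M).
  - by move=> i; have := ler_norm (- b i); rewrite normrN; lra.
  - move=> B uB; apply: le_trans (lerD (bM _ uB) (bM _ uB)).
    by rewrite -big_split /=; apply: ler_sum => i _; rewrite lerD2r ler_norm.
  exists (t + (-1) * s); apply: eq_has_csum (has_csumD ht (has_csumZ (-1) hs)) => i.
  by rewrite mulN1r rmorphD addrK.
have [|s hs] := real_case (fun i => complex.Re (a i)).
  move=> i; case: (a i) => x y /=; rewrite -[leLHS]sqrtr_sqr.
  by rewrite ler_wsqrtr// lerDl sqr_ge0.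
have [|t ht] := real_case (fun i => complex.Im (a i)).
  move=> i; case: (a i) => x y /=; rewrite -[leLHS]sqrtr_sqr.
  by rewrite ler_wsqrtr// lerDr sqr_ge0.
exists (s + 'i%C * t); apply: eq_has_csum (has_csumD hs (has_csumZ 'i%C ht)) => i.
by rewrite [RHS]complexE.
Qed.

End Theory.
End UnconditionalSums.

(** * Summability of the cosine coefficients *)

Section WeightSums.
Context {R : realType} {d : nat}.
Local Notation K := {ffun 'I_d -> int}.
Implicit Types (h k l : K).

(** Cauchy condensation: the 2^n terms with 2^n <= m < 2^(n+1) add up to at most 2^n / 2^(np) = q^n,
    where q = 2^(1-p) < 1. *)
Lemma p_series_bounded (p : R) : 1 < p ->
  exists C : R, forall N, \sum_(1 <= m < N) (m%:R `^ p)^-1 <= C.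
Proof.
move=> p1; have p0 : 0 < p by exact: lt_trans p1.
pose q : R := 2 / 2 `^ p.
have q0 : 0 < q by rewrite divr_gt0// powR_gt0.
have q1 : q < 1.
  rewrite ltr_pdivrMr ?powR_gt0// mul1r -[X in X < _](@powRr1 _ 2)//.
  by rewrite /powR !pnatr_eq0 /= ltr_expR ltr_pM2r// ln_gt0// ltr1n.
have h0 : 0 < 1 - q by rewrite subr_gt0.
have pow2 n : ((2 ^ n)%N%:R : R) `^ p = (2 `^ p) ^+ n.
  by rewrite natrX -[2 ^+ n]powR_mulrn// -powRrM mulrC powRrM powR_mulrn// powR_ge0.
have block n : \sum_(1 <= m < 2 ^ n) ((m%:R : R) `^ p)^-1 <= \sum_(i < n) q ^+ i.
  elim: n => [|n IH]; first by rewrite expn0 big_geq// big_ord0.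
  rewrite (@big_cat_nat _ _ _ (2 ^ n))/=; first last.
  - by rewrite leq_exp2l.
  - by rewrite expn_gt0.
  rewrite big_ord_recr /= lerD//.
  apply: (@le_trans _ _ (\sum_(2 ^ n <= m < 2 ^ n.+1) (((2 ^ n)%N%:R : R) `^ p)^-1)).
    rewrite big_nat [leRHS]big_nat; apply: ler_sum => m /andP[nm _].
    rewrite lef_pV2 ?posrE ?powR_gt0 ?ltr0n ?expn_gt0//; last first.
      by rewrite (leq_trans _ nm)// expn_gt0.
    by rewrite ge0_ler_powR ?nnegrE ?ler_nat// ltW.
  rewrite sumr_const_nat expnS mul2n -addnn addnK pow2.
  by rewrite -(mulr_natl _ (2 ^ n)) natrX /q exprMn exprVn.
exists (1 - q)^-1 => N.
apply: (@le_trans _ _ (\sum_(i < N) q ^+ i)).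
  apply: le_trans (block N); rewrite /index_iota.
  apply: ler_sum_subset; first by move=> i; rewrite invr_ge0 powR_ge0.
    exact: iota_uniq.
  move=> i; rewrite !mem_iota => /andP[-> /=] iN.
  have := ltn_expl N (isT : 1 < 2)%N; lia.
rewrite -[leRHS]mul1r ler_pdivlMr// mulrC -[1 - q]opprB mulNr -subrX1 opprB gerBl.
by rewrite exprn_ge0// ltW.
Qed.

Lemma ler_sum_surj (T : finType) (I : eqType) (F : I -> R) (g : T -> I) (B : seq I) :
  (forall i, 0 <= F i) -> uniq B -> (forall i, i \in B -> exists t, g t = i) ->
  \sum_(i <- B) F i <= \sum_t F (g t).
Proof.
move=> F0 uB Bg; rewrite -[leRHS]big_enum /= -(big_map g xpredT F).
apply: ler_sum_subset => // i /Bg[t <-].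
by apply: map_f; rewrite mem_enum.
Qed.

Lemma sgn_act_absv h : sgn_act [ffun j => h j < 0] (absv h) = h.
Proof.
apply/ffunP => j; rewrite !ffunE; case: ltP => hj.
  by rewrite expr1 mulN1r ltr0_norm// opprK.
by rewrite expr0 mul1r ger0_norm.
Qed.

(** Every h is recovered from |h| by at least one of the 2^d sign vectors, and for a fixed sign
    vector [absv] is injective on the h it recovers; each sign vector thus contributes at most
    [S]. *)
Lemma ler_sum_absv (G : K -> R) (S : R) : (forall k, 0 <= G k) ->
  (forall B, uniq B -> (forall k, k \in B -> Zplus k) -> \sum_(k <- B) G k <= S) ->
  forall B, uniq B -> \sum_(h <- B) G (absv h) <= (2 ^ d)%:R * S.
Proof.
move=> G0 GS B uB.
apply: (@le_trans _ _ (\sum_(s : {ffun 'I_d -> bool})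
    \sum_(h <- B | sgn_act s (absv h) == h) G (absv h))).
  under [leRHS]eq_bigr do rewrite big_mkcond.
  rewrite exchange_big /=; apply: ler_sum => h _.
  rewrite (bigD1 [ffun j => h j < 0])//= sgn_act_absv eqxx lerDl.
  by apply: sumr_ge0 => s _; case: ifP.
apply: (@le_trans _ _ (\sum_(s : {ffun 'I_d -> bool}) S)); last first.
  by rewrite sumr_const card_ffun card_bool card_ord mulr_natl.
apply: ler_sum => s _; rewrite -big_filter -(big_map (@absv d) xpredT G).
apply: GS.
  rewrite map_inj_in_uniq ?filter_uniq// => h l.
  rewrite !mem_filter => /andP[/eqP hE _] /andP[/eqP lE _] E.
  by rewrite -hE -lE E.
by move=> k /mapP[h _ ->]; exact: absv_ge0.
Qed.

Variables (alpha : R) (gamma : nat -> R).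
Hypotheses (alpha_gt : 1 / 2 < alpha) (gamma_le1 : forall j, gamma j <= 1)
  (gamma_gt0 : forall j, 0 < gamma j).

Lemma weight1_gt0 j m : 0 < weight1 alpha (gamma j) m.
Proof.
rewrite /weight1; case: eqP => // /eqP m0; rewrite divr_gt0// powR_gt0//.
by rewrite ltr0z normr_gt0.
Qed.

Lemma weight_gt0 k : 0 < weight alpha gamma k.
Proof. by apply: prodr_gt0 => j _; exact: weight1_gt0. Qed.

Lemma weight_absv k : weight alpha gamma (absv k) = weight alpha gamma k.
Proof.
by apply: eq_bigr => j _; rewrite ffunE /weight1 normr_eq0 normr_id.
Qed.

(** Over a box the sum of a product is a product of one-dimensional sums, each at most 1 + C per
    sign: 1 for the frequency 0 and the p-series for the others. *)
Lemma inv_weight_summable : exists C : R, forall B : seq K, uniq B ->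
  \sum_(h <- B) (weight alpha gamma h)^-1 <= C.
Proof.
have [C HC] := @p_series_bounded (2 * alpha) ltac:(by have := alpha_gt; lra).
exists ((2 * (1 + C)) ^+ d) => B uB.
pose N := (\max_(h <- B) \max_(j < d) `|h j|%N).+1.
(* Signs and moduli below [N] cover every frequency of [B]. A zero coordinate is hit with both
   signs; for nonnegative terms this overcounting only enlarges the bound. *)
pose g (u : {ffun 'I_d -> bool * 'I_N}) : K := [ffun j => (-1) ^+ (u j).1 * (u j).2%:Z].
apply: (@le_trans _ _ (\sum_u (weight alpha gamma (g u))^-1)).
  apply: (@ler_sum_surj _ _ (fun h => (weight alpha gamma h)^-1)) => //.
    by move=> i; rewrite invr_ge0 ltW// weight_gt0.
  move=> h hB; have hN j : (`|h j| < N)%N.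
    rewrite ltnS (leq_trans _ (leq_bigmax_seq _ hB isT))//.
    exact: (leq_bigmax_cond (F := fun j : 'I_d => `|h j|%N)).
  exists [ffun j => (h j < 0, Ordinal (hN j))].
  apply/ffunP => j; rewrite !ffunE /=; case: ltP => hj.
    by rewrite expr1; lia.
  by rewrite expr0; lia.
have -> : \sum_u (weight alpha gamma (g u))^-1 =
    \prod_(j < d) \sum_(b : bool * 'I_N) (weight1 alpha (gamma j) ((-1) ^+ b.1 * b.2%:Z))^-1.
  rewrite bigA_distr_bigA /=; apply: eq_bigr => u _.
  by rewrite /weight prodfV; congr (_^-1); apply: eq_bigr => j _; rewrite ffunE.
rewrite -[d in leRHS]card_ord -prodr_const; apply: ler_prod => j _.
apply/andP; split.
  by apply: sumr_ge0 => b _; rewrite invr_ge0 ltW// weight1_gt0.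
rewrite -(pair_bigA _ (fun (b : bool) (m : 'I_N) =>
  (weight1 alpha (gamma j) ((-1) ^+ b * m%:Z))^-1)) /=.
have one_sign (b : bool) : \sum_(m < N) (weight1 alpha (gamma j) ((-1) ^+ b * m%:Z))^-1 <= 1 + C.
  rewrite -(big_mkord xpredT (fun m => (weight1 alpha (gamma j) ((-1) ^+ b * m%:Z))^-1)).
  rewrite big_ltn// mulr0 {1}/weight1 eqxx invr1 lerD2l.
  apply: le_trans (HC N); rewrite big_nat [leRHS]big_nat.
  apply: ler_sum => m /andP[m1 _].
  rewrite /weight1 mulf_eq0 expf_eq0 /= oppr_eq0 oner_eq0 andbF /=.
  rewrite (_ : (m%:Z == 0) = false); last by lia.
  (* The inverse weight is gamma_j / m^(2 alpha), below the p-series term because gamma_j <= 1. *)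
  rewrite normrM normrX normrN1 expr1n mul1r invfM invrK ler_piMr//.
by rewrite big_bool [leRHS]mulr_natl mulr2n; apply: lerD; exact: one_sign.
Qed.

Variable f : d.-tuple R -> R[i].
Hypothesis f_cosine : cosine_space alpha gamma f.

Lemma fhat_summable : exists C : R, forall B : seq K, uniq B ->
  \sum_(h <- B) normc (fhat f (absv h)) <= C.
Proof.
have [C HC] := inv_weight_summable.
pose G k := normc (fhat f k) ^+ 2 * weight alpha gamma k.
have G0 k : 0 <= G k by rewrite mulr_ge0 ?sqr_ge0// ltW// weight_gt0.
have fin : cosine_normsq alpha gamma f \is a fin_num.
  rewrite ge0_fin_numE; first by case: f_cosine.
  by apply: esum_ge0 => k _; rewrite lee_fin; exact: G0.
have GS B : uniq B -> (forall k, k \in B -> Zplus k) ->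
    \sum_(k <- B) G k <= fine (cosine_normsq alpha gamma f).
  move=> uB ZB; rewrite -lee_fin fineK// -sumEFin.
  apply: ereal_sup_ubound; exists [set` B].
    by split; [exact: finite_seq|move=> k /= /ZB].
  by rewrite -fsbig_seq.
exists ((2 ^ d)%:R * fine (cosine_normsq alpha gamma f) + C) => B uB.
apply: le_trans (lerD (ler_sum_absv G0 GS uB) (HC _ uB)).
rewrite -big_split; apply: ler_sum => h _.
rewrite /G weight_absv; have := weight_gt0 h.
set w := weight _ _ _; set a := normc _ => w0.
(* The inequality a <= a^2 w + 1/w, multiplied by w, reads a w <= (a w)^2 + 1. *)
rewrite -(@ler_pM2r _ w)// mulrDl mulVf ?gt_eqF//.
by have := sqr_ge0 (a * w - 1); have := sqr_ge0 (a * w); nra.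
Qed.

(** Each member contributes at least 1/M to the bounded sum of inverse weights, so there are at most
    C M of them. *)
Lemma finite_hyperbolic_cross M : 0 < M ->
  finite_set (@hyperbolic_cross R d alpha gamma M).
Proof.
move=> M0; apply: contrapT => infH; have [C HC] := inv_weight_summable.
have [n Hn] : exists n : nat, C * M < n%:R.
  by exists (Num.truncn (C * M)).+1; exact: truncnS_gt.
have [B BH nB] := infinite_set_fset n infH.
have := HC _ (finmap.fset_uniq B); apply/negP; rewrite -ltNge.
apply: (@lt_le_trans _ _ (\sum_(h <- B) M^-1)).
  rewrite big_const_seq count_predT iter_addr_0 -mulr_natl ltr_pdivlMr//.
  by rewrite (lt_le_trans Hn)// ler_nat.
rewrite big_seq [leRHS]big_seq; apply: ler_sum => h hB.
by rewrite lef_pV2 ?posrE ?weight_gt0//; case: (BH _ hB).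
Qed.

End WeightSums.

(** * Lattice characters and aliasing *)

Section Characters.
Context {R : realType}.
Local Notation C := (R[i]).
Implicit Types (x y : R) (m l : int).

Definition cis x : C := Complex (cos x) (sin x).

Lemma cisD x y : cis (x + y) = cis x * cis y.
Proof. by rewrite /cis cosD sinD; congr Complex; ring. Qed.

Lemma cis0 : cis 0 = 1.
Proof. by rewrite /cis cos0 sin0. Qed.

Lemma normc_cis x : normc (cis x) = 1.
Proof. by rewrite /= cos2Dsin2 sqrtr1. Qed.

Lemma cos_cis x : (cos x)%:C%C = 2^-1 * (cis x + cis (- x)).
Proof.
rewrite /cis cosN sinN; apply/eqP; rewrite eq_complex /=.
by apply/andP; split; apply/eqP; simpc; field.
Qed.

Lemma cis_sum (I : Type) (s : seq I) (F : I -> R) :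
  cis (\sum_(i <- s) F i) = \prod_(i <- s) cis (F i).
Proof.
by elim: s => [|i s IH]; rewrite ?big_nil ?cis0// !big_cons cisD IH.
Qed.

Lemma cisMn x (k : nat) : cis (k%:R * x) = cis x ^+ k.
Proof.
elim: k => [|k IH]; first by rewrite mul0r cis0.
by rewrite exprS -IH -cisD -natr1 mulrDl mul1r addrC.
Qed.

Lemma cis_2pi_int m : cis (2 * pi * m%:~R) = 1.
Proof.
have N (k : nat) : cis (k%:R * (2 * pi)) = 1.
  rewrite cisMn; have -> : cis (2 * pi) = 1.
    by rewrite /cis mulr_natl cos2pi sin2pi.
  exact: expr1n.
case: m => k; first by rewrite mulrC N.
have := cis0; rewrite -{1}(subrr (k.+1%:R * (2 * pi))) cisD N mul1r => <-.
by rewrite NegzE mulrNz mulrN mulrC.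
Qed.

Lemma cos_2pi_int x m : cos (x + 2 * pi * m%:~R) = cos x.
Proof.
by have := congr1 (@complex.Re _) (cisD x (2 * pi * m%:~R)); rewrite cis_2pi_int mulr1.
Qed.

Lemma cis_eq1 x : 0 <= x < 2 * pi -> cis x = 1 -> x = 0.
Proof.
move=> /andP[x0 x2] /(congr1 (@complex.Re _)) /= cx.
apply/eqP; apply: contraT => xn0.
have xgt : 0 < x by rewrite lt_neqAle eq_sym xn0.
(* By the half-angle formula cos x = 1 - 2 sin(x/2)^2, and x/2 lies in (0,pi), so cos x < 1. *)
have s0 : 0 < sin (x / 2) by apply: sin_gt0_pi; apply/andP; split; lra.
have := cx; rewrite [x in cos x](splitr x) -mulr2n cos_mulr2n.
have := cos2Dsin2 (x / 2); have : 0 < sin (x / 2) ^+ 2 by rewrite exprn_gt0.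
set c2 := cos _ ^+ 2; set s2 := sin _ ^+ 2; rewrite mulr2n.
lra.
Qed.

Variable n : nat.
Hypothesis n_gt0 : (0 < n)%N.

Definition root_power m : C := cis (2 * pi * m%:~R / n%:R).

Lemma root_powerD m l : root_power (m + l) = root_power m * root_power l.
Proof. by rewrite /root_power -cisD intrD; congr cis; ring. Qed.

Lemma root_power_eq1 m : (root_power m == 1) = (m == 0 %[mod n%:Z])%Z.
Proof.
have n0 : (n%:R : R) != 0 by rewrite pnatr_eq0 -lt0n.
have mult q : root_power (q * n%:Z) = 1.
  by rewrite /root_power intrM -(cis_2pi_int q); congr cis; field.
have red : root_power m = root_power (m %% n%:Z)%Z.
  by rewrite {1}(divz_eq m n%:Z) root_powerD mult mul1r.
rewrite mod0z red; apply/eqP/eqP => [|->]; last first.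
  by rewrite /root_power mulr0 mul0r cis0.
have nz : n%:Z != 0 :> int by lia.
have r0 := modz_ge0 m nz.
have rn : (m %% n%:Z < n%:Z)%Z by apply: ltz_pmod; lia.
have npos : (0 : R) < n%:R by rewrite ltr0n.
have pi0 := pi_gt0 R.
have ri : (0 : R) <= (m %% n%:Z)%Z%:~R by rewrite ler0z.
move=> /cis_eq1 H; have {}H : 2 * pi * (m %% n)%Z%:~R / n%:R = 0 :> R.
  apply: H; rewrite divr_ge0 ?mulr_ge0 ?(ltW pi0) ?(ltW npos)//=.
  by rewrite ltr_pdivrMr// ltr_pM2l ?mulr_gt0// -[n%:R]/(n%:Z%:~R) ltr_int.
move: H => /eqP; rewrite !mulf_eq0 invr_eq0 (negbTE n0) orbF pnatr_eq0 /=.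
by rewrite (gt_eqF pi0) /= intr_eq0 => /eqP.
Qed.

Lemma root_power_mean m :
  n%:R^-1 * \sum_(1 <= i < n.+1) root_power (m * i%:Z) = ((m == 0 %[mod n%:Z])%Z%:R : C).
Proof.
have n0 : (n%:R : C) != 0 by rewrite pnatr_eq0 -lt0n.
have powE i : root_power (m * i%:Z) = root_power m ^+ i.
  rewrite -cisMn; congr cis; rewrite intrM; ring.
under eq_bigr do rewrite powE.
rewrite -root_power_eq1; case: eqP => [->|/eqP w1].
  under eq_bigr do rewrite expr1n.
  by rewrite sumr_const_nat subn1 /= mulVf.
apply/eqP; rewrite mulf_eq0; apply/orP; right.
have wn : root_power m ^+ n = 1.
  have n0R : (n%:R : R) != 0 by rewrite pnatr_eq0 -lt0n.
  by rewrite -powE /root_power -(cis_2pi_int m); congr cis; rewrite intrM; field.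
(* Shifting the range 1..n to 0..n-1 extracts one factor of the root; the remaining geometric sum
   vanishes because w^n = 1 and w <> 1. *)
rewrite big_add1 /= big_mkord.
under eq_bigr do rewrite exprS.
rewrite -big_distrr /= mulf_eq0; apply/orP; right.
have := subrX1 (root_power m) n; rewrite wn subrr => /esym /eqP.
by rewrite mulf_eq0 subr_eq0 (negbTE w1).
Qed.

End Characters.

(** * Cosines and exponentials at the lattice nodes *)

Section TentNode.
Context {R : realType} {d : nat}.
Local Notation C := (R[i]).
Local Notation K := {ffun 'I_d -> int}.
Variables (n : nat) (z : {ffun 'I_d -> 'I_n}).
Implicit Types (h k l : K).

(** On the left half of [0,1] the tent map is 2x, on the right half 2 - 2x; evenness and 2
    pi-periodicity of cosine identify the two branches and also undo the fractional part. *)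
Lemma cos_tent_frac (l : int) (y : R) :
  cos (pi * l%:~R * tent (Defs.frac y)) = cos (2 * pi * l%:~R * y).
Proof.
have -> : cos (2 * pi * l%:~R * y) = cos (2 * pi * l%:~R * Defs.frac y).
  rewrite -(cos_2pi_int (2 * pi * l%:~R * Defs.frac y) (l * Num.floor y)) /Defs.frac intrM.
  by congr cos; ring.
rewrite /tent; set x := Defs.frac y; case: (lerP (2 * x) 1) => hx.
  by congr cos; ring.
rewrite -cosN -(cos_2pi_int _ l).
by congr cos; ring.
Qed.

Definition lattice_form h : int := \sum_(j < d) h j * (z j : nat)%:Z.

Lemma lattice_formD h k : lattice_form (h + k) = lattice_form h + lattice_form k.
Proof. by rewrite -big_split; apply: eq_bigr => j _; rewrite ffunE mulrDl. Qed.

Lemma root_power_form (h : K) (i : nat) : root_power (R := R) n (lattice_form h * i%:Z) =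
  \prod_(j < d) cis (2 * pi * (h j)%:~R * (i%:R * (z j : nat)%:R / n%:R)).
Proof.
rewrite -cis_sum /root_power; congr cis.
rewrite /lattice_form intrM rmorph_sum /= mulr_suml mulr_sumr mulr_suml.
by apply: eq_bigr => j _; rewrite intrM; ring.
Qed.

Lemma cosmono_tent_node k (i : nat) : cosmono k (tent_node z i : d.-tuple R) =
  \prod_(j < d) cos (2 * pi * (k j)%:~R * (i%:R * (z j : nat)%:R / n%:R)).
Proof. by apply: eq_bigr => j _; rewrite tnth_mktuple cos_tent_frac. Qed.

Lemma phi_tent_node k (i : nat) : (phi k (tent_node z i : d.-tuple R))%:C%C =
  \sum_(s : {ffun 'I_d -> bool}) (Num.sqrt 2 ^+ nnz k / 2 ^+ d)%:C%C *
    root_power n (lattice_form (sgn_act s k) * i%:Z).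
Proof.
rewrite phiE cosmono_tent_node rmorphM /= rmorph_prod /=.
under eq_bigr => j _.
  rewrite cos_cis (_ : _ + _ = \sum_(b : bool)
     cis (2 * pi * ((-1) ^+ b * k j)%:~R * (i%:R * (z j : nat)%:R / n%:R))).
    over.
  rewrite big_bool /= expr0 expr1 mul1r mulN1r addrC; congr (_ + _).
  by congr cis; rewrite mulrNz; ring.
rewrite big_split /= prodr_const card_ord bigA_distr_bigA /= mulrA -mulr_sumr.
congr (_ * _).
  rewrite [RHS]rmorphM; congr (_ * _).
  rewrite exprVn [RHS]fmorphV; congr (_^-1).
  by rewrite [RHS]rmorphXn /=; congr (_ ^+ _); rewrite (rmorph_nat (real_complex R)).
apply: eq_bigr => s _; rewrite root_power_form; apply: eq_bigr => j _.
by rewrite ffunE.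
Qed.

End TentNode.

(** * The aliasing formula for the lattice coefficients *)

Section Aliasing.
Context {R : realType} {d : nat}.
Local Notation C := (R[i]).
Local Notation K := {ffun 'I_d -> int}.
Implicit Types (h k l : K).

Lemma sgn_actK (s : {ffun 'I_d -> bool}) : involutive (@sgn_act d s).
Proof.
by move=> h; apply/ffunP => j; rewrite !ffunE mulrA -expr2 sqrr_sign mul1r.
Qed.

Lemma sgn_actD (s : {ffun 'I_d -> bool}) h k : sgn_act s (h + k) = sgn_act s h + sgn_act s k.
Proof. by apply/ffunP => j; rewrite !ffunE mulrDr. Qed.

Lemma absv_sgn_act (s : {ffun 'I_d -> bool}) h : absv (sgn_act s h) = absv h.
Proof. by apply/ffunP => j; rewrite !ffunE normrMsign. Qed.

Lemma nnz_sgn_act (s : {ffun 'I_d -> bool}) h : nnz (sgn_act s h) = nnz h.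
Proof. by rewrite -nnz_absv absv_sgn_act nnz_absv. Qed.

Lemma absv_id k : Zplus k -> absv k = k.
Proof. by move=> k0; apply/ffunP => j; rewrite ffunE ger0_norm. Qed.

(* Signs are only chosen on the support of l, so that each point of the fibre
   is listed once. *)
Definition absv_fiber l : seq K :=
  if l == absv l then
    [seq sgn_act s l | s <- enum (family (fun j => [pred b : bool | b ==> (l j != 0)]))]
  else [::].

Lemma absv_fiber_uniq l : uniq (absv_fiber l).
Proof.
rewrite /absv_fiber; case: eqP => // _.
rewrite map_inj_in_uniq ?enum_uniq// => s t; rewrite !mem_enum => /familyP hs /familyP ht E.
apply/ffunP => j; have := hs j; have := ht j; rewrite !inE.
have := congr1 (fun h : K => h j) E; rewrite /= !ffunE.
have [->|lj] := eqVneq (l j) 0; first by rewrite !implybF => _ /negbTE -> /negbTE ->.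
move=> /(mulIf lj) sE _ _; case: (s j) (t j) sE => [] [] //=; rewrite expr0 expr1; lia.
Qed.

Lemma mem_absv_fiber l h : (h \in absv_fiber l) = (absv h == l).
Proof.
rewrite /absv_fiber; apply/idP/eqP => [|<-].
  by case: eqP => // lE /mapP[s _ ->]; rewrite absv_sgn_act -lE.
rewrite (absv_id (absv_ge0 h)) eqxx.
apply/mapP; exists [ffun j => h j < 0]; last by rewrite sgn_act_absv.
rewrite mem_enum; apply/familyP => j; rewrite !inE !ffunE normr_eq0.
by case: ltgtP.
Qed.

Lemma normc_nat (m : nat) : normc (m%:R : C) = m%:R.
Proof. by rewrite -(rmorph_nat (real_complex R)) normcR normr_nat. Qed.

Lemma sqrt2_gt0 : 0 < Num.sqrt 2 :> R.
Proof. by rewrite sqrtr_gt0. Qed.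

Variables (n : nat) (z : {ffun 'I_d -> 'I_n}).
Hypothesis n_gt0 : (0 < n)%N.

(** Each nonzero coordinate sums two opposite exponentials to twice a cosine, each zero coordinate
    gives 1. The resulting 2^(|l|_0) is shared equally between the normalisation of [phi] and the
    explicit power of sqrt(2). *)
Lemma sum_absv_fiber l (i : nat) : Zplus l ->
  \sum_(h <- absv_fiber l) root_power n (lattice_form z h * i%:Z) =
  (Num.sqrt 2 ^+ nnz l * phi l (tent_node z i : d.-tuple R))%:C%C.
Proof.
move=> l0; rewrite /absv_fiber absv_id// eqxx big_map big_enum /=.
under eq_bigr => s _.
  rewrite root_power_form.
  under eq_bigr => j _ do rewrite ffunE.
  over.
rewrite -(bigA_distr_big_dep (fun j => [pred b : bool | b ==> (l j != 0)])
  (fun j b => cis (2 * pi * ((-1) ^+ b * l j)%:~R * (i%:R * (z j : nat)%:R / n%:R)))).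
rewrite phiE cosmono_tent_node mulrA -expr2 exprAC sqr_sqrtr// rmorphM /= rmorph_prod /=.
have -> : (2 ^+ nnz l)%:C%C = \prod_(j < d) (if l j != 0 then 2%:C%C else 1) :> C.
  rewrite rmorphXn /nnz -prodr_const big_mkcond; apply: eq_bigr => j _.
  by rewrite inE.
rewrite -big_split; apply: eq_bigr => j _.
rewrite big_mkcond big_bool.
have [->|lj] := eqVneq (l j) 0.
  by rewrite /= add0r !mulr0 !mul0r cis0 cos0 mulr1.
rewrite /= expr0 expr1 mul1r mulN1r cos_cis [RHS]mulrA.
rewrite (_ : (2%:C)%C * 2^-1 = 1) ?mul1r; last first.
  by rewrite rmorph_nat mulfV// pnatr_eq0.
by rewrite addrC; congr (_ + _); congr cis; rewrite mulrNz; ring.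
Qed.

Variables (alpha : R) (gamma : nat -> R).
Hypotheses (alpha_gt : 1 / 2 < alpha) (gamma_le1 : forall j, gamma j <= 1)
  (gamma_gt0 : forall j, 0 < gamma j).
Variable f : d.-tuple R -> R[i].
Hypothesis f_cosine : cosine_space alpha gamma f.

(** The coefficient of exp(2 pi i h.y) in the cosine series of f composed with the tent map: phi_k
    spreads evenly over 2^(|k|_0) frequencies, and sqrt(2)^(|k|_0) / 2^(|k|_0) is
    sqrt(2)^(-|k|_0). *)
Definition fourier_coef h : C := fhat f (absv h) * (Num.sqrt 2 ^- nnz h)%:C%C.

(** Bounded factors preserve absolute summability; [w] is a lattice character in one use and a
    multiple of a dual-lattice indicator in the other. *)
Lemma fourier_coef_has_csum (w : K -> C) (B : R) : (forall h, normc (w h) <= B) ->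
  exists s, has_csum (fun h => fourier_coef h * w h) s.
Proof.
move=> wB; have [M HM] := fhat_summable alpha_gt gamma_le1 gamma_gt0 f_cosine.
apply: (@abs_has_csum _ _ _ (M * B)) => T uT.
have B0 : 0 <= B by apply: le_trans (wB 0); exact: normc_ge0.
apply: le_trans (ler_wpM2r B0 (HM _ uT)).
rewrite big_distrl; apply: ler_sum => h _.
rewrite !ComplexField.Normc.normcM normcR ler_pM ?mulr_ge0 ?normc_ge0//.
rewrite ler_piMr ?normc_ge0// ger0_norm ?invr_ge0 ?exprn_ge0// invf_le1 ?exprn_gt0 ?sqrt2_gt0//.
by rewrite exprn_ege1// -[leLHS]sqrtr1 ler_wsqrtr// ler1n.
Qed.

Lemma crep_tent_node_has_csum (i : nat) :
  has_csum (fun h => fourier_coef h * root_power n (lattice_form z h * i%:Z))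
    (crep f (tent_node z i)).
Proof.
have [|s hs] := @fourier_coef_has_csum (fun h => root_power n (lattice_form z h * i%:Z)) 1.
  by move=> h; rewrite normc_cis.
suff -> : crep f (tent_node z i) = s by [].
apply: has_csumE.
apply: eq_has_csum (has_csum_group absv_fiber_uniq mem_absv_fiber hs) => l.
(* Outside Z_+^d the fibre of [absv] is empty, which agrees with the value 0 that [csum] assigns
   there. *)
case: ifPn => [|lZ]; last first.
  rewrite /absv_fiber; case: eqP => [lE|_]; last by rewrite big_nil.
  by case/negP: lZ; rewrite inE lE; exact: absv_ge0.
rewrite inE => lZ.
rewrite big_seq (eq_bigr (fun h => (fhat f l * (Num.sqrt 2 ^- nnz l)%:C%C) *
    root_power n (lattice_form z h * i%:Z))); last first.
  by move=> h; rewrite mem_absv_fiber => /eqP <-; rewrite nnz_absv.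
rewrite -big_seq -mulr_sumr sum_absv_fiber// -mulrA -rmorphM mulrA mulVf ?mul1r//.
Qed.

Definition lattice_coef k : C := n%:R^-1 * (\sum_(1 <= i < n.+1)
  crep f (tent_node z i) * (phi k (tent_node z i))%:C%C).

Definition alias_term k h : C := \sum_(s : {ffun 'I_d -> bool})
  fhat f (absv (sgn_act s h + k)) *
  (Num.sqrt 2 ^ (- (nnz (sgn_act s h + k))%:Z + (nnz k)%:Z) / 2 ^+ d)%:C%C.

Lemma dual_latticeE h : dual_lattice z h <-> (lattice_form z h == 0 %[mod n%:Z])%Z.
Proof. by split=> [/eqP|/eqP]. Qed.

(** The average is a sum over sign vectors s of series supported where h - s(k) is dual. The shift
    by s(k) depends on s, so each series is translated separately before they are added; then all
    share the condition that h is dual. *)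
Lemma lattice_coef_has_csum k :
  has_csum (fun h => if h \in dual_lattice z then alias_term k h else 0) (lattice_coef k).
Proof.
pose c : C := (Num.sqrt 2 ^+ nnz k / 2 ^+ d)%:C%C.
pose T (s : {ffun 'I_d -> bool}) h : C := fourier_coef h *
  (c * ((lattice_form z (h - sgn_act s k) == 0 %[mod n%:Z])%Z)%:R).
have hT s : exists t, has_csum (T s) t.
  apply: (@fourier_coef_has_csum _ (normc c)) => h; rewrite ComplexField.Normc.normcM.
  by rewrite normc_nat; case: eqP => _; rewrite ?mulr1 ?mulr0 ?normc_ge0.
have [t ht] := choice hT.
have mean_eq h : \sum_(s : {ffun 'I_d -> bool}) T s h = n%:R^-1 * \sum_(1 <= i < n.+1)
    (phi k (tent_node z i))%:C%C * (fourier_coef h * root_power n (lattice_form z h * i%:Z)).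
  under [in RHS]eq_bigr => i _ do rewrite phi_tent_node mulr_suml.
  rewrite exchange_big mulr_sumr /=.
  (* Multiplying by phi_k produces the frequencies h + s(k), whereas [T] is written with h - s(k);
     flipping all signs exchanges the two. *)
  rewrite (reindex_inj (h := fun s : {ffun 'I_d -> bool} => [ffun j => ~~ s j])) /=; last first.
    move=> s u /ffunP E; apply/ffunP => j; have := E j; rewrite !ffunE; exact: negb_inj.
  apply: eq_bigr => s _; rewrite /T -root_power_mean// -/c.
  rewrite !mulr_sumr; apply: eq_bigr => i _.
  have -> : h - sgn_act [ffun j => ~~ s j] k = sgn_act s k + h.
    apply/ffunP => j; rewrite !ffunE addrC; congr (_ + _).
    by rewrite signrN mulNr opprK.
  by rewrite lattice_formD mulrDl root_powerD; ring.
have tsum : \sum_s t s = lattice_coef k.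
  apply: (@has_csum_unique _ _ (fun h => \sum_s T s h)); first exact: has_csum_sum.
  have := has_csumZ n%:R^-1 (has_csum_sum (index_iota 1 n.+1) (fun i =>
    has_csumZ (phi k (tent_node z i))%:C%C (crep_tent_node_has_csum i))).
  rewrite /lattice_coef; under [in X in _ -> X]eq_bigr do rewrite mulrC.
  by apply: eq_has_csum => h; rewrite mean_eq.
rewrite -tsum.
have hT' s : has_csum (fun h => T s (h + sgn_act s k)) (t s).
  by apply: (has_csum_reindex (p := fun h => h - sgn_act s k)) (ht s) => h;
    rewrite ?subrK ?addrK.
apply: eq_has_csum (has_csum_sum (index_enum _) hT') => h.
have dualE : (h \in dual_lattice z) = (lattice_form z h == 0 %[mod n%:Z])%Z.
  by apply/idP/idP; rewrite inE; move/dual_latticeE.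
rewrite dualE; case: ifP => hd; last first.
  by apply: big1 => s _; rewrite /T addrK hd !mulr0.
apply: eq_bigr => s _; rewrite /T addrK hd mulr1 /fourier_coef.
(* The coefficient depends only on absolute values, so the outer sign change disappears and s(h) + k
   remains. *)
have -> : h + sgn_act s k = sgn_act s (sgn_act s h + k) by rewrite sgn_actD sgn_actK.
rewrite absv_sgn_act nnz_sgn_act -mulrA; congr (_ * _).
rewrite /c -rmorphM; congr (_%:C)%C.
by rewrite expfzDr ?gt_eqF ?sqrt2_gt0// mulrA -exprnN.
Qed.

(** All 2^d sign vectors fix the zero frequency, and each contributes f^(k) / 2^d. *)
Lemma alias_term0 k : Zplus k -> alias_term k 0 = fhat f k.
Proof.
move=> k0; rewrite /alias_term (eq_bigr (fun=> fhat f k * (2 ^- d)%:C%C)); last first.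
  move=> s _; rewrite (_ : sgn_act s 0 = 0) ?add0r ?absv_id//; last first.
    by apply/ffunP => j; rewrite !ffunE mulr0.
  by rewrite addNr expr0z mul1r.
rewrite sumr_const card_ffun card_bool card_ord -(mulr_natr _ (2 ^ d)) -mulrA.
have -> : (2 ^- d)%:C%C * (2 ^ d)%:R = 1 :> C; last exact: mulr1.
rewrite -(rmorph_nat (real_complex R)) -[LHS]rmorphM natrX mulVf ?rmorph1//.
Qed.

Lemma alias_has_csum k : Zplus k ->
  has_csum (fun h => if h \in [set h | dual_lattice z h /\ h <> 0] then alias_term k h else 0)
    (lattice_coef k - fhat f k).
Proof.
move=> k0; have := has_csumD (lattice_coef_has_csum k)
  (has_csumZ (-1) (has_csum_pred1 (0 : K) (fhat f k))).
rewrite mulN1r; apply: eq_has_csum => h.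
have [->|h0] := eqVneq h 0.
  have d0 : (0 : K) \in dual_lattice z.
    by rewrite inE; apply/dual_latticeE; rewrite /lattice_form big1// => j _; rewrite ffunE mul0r.
  have d1 : ((0 : K) \in [set h | dual_lattice z h /\ h <> 0]) = false.
    by apply/negP; rewrite inE => -[_ /(_ erefl)].
  by rewrite d0 d1 alias_term0// mulN1r subrr.
rewrite mulr0 addr0; congr (if _ then _ else _).
apply/idP/idP => [|]; rewrite !inE => hd; last by case: hd.
by split => //; exact/eqP.
Qed.

End Aliasing.

(** * The error formula *)

Unset Implicit Arguments.

Theorem theorem5 (R : realType) (d n : nat) (alpha : R) (gamma : nat -> R)
    (M : R) (z : {ffun 'I_d -> 'I_n}) (f : d.-tuple R -> R[i])
    (d_gt0 : (0 < d)%N) (n_gt0 : (0 < n)%N) (alpha_gt : 1 / 2 < alpha)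
    (gamma_le1 : gamma 0%N <= 1)
    (gamma_noninc : forall j, gamma j.+1 <= gamma j)
    (gamma_gt0 : forall j, 0 < gamma j)
    (M_ge1 : 1 <= M)
    (f_cosine : cosine_space alpha gamma f) :
  let H := hyperbolic_cross (d := d) alpha gamma M in
  let dual0 := [set h | dual_lattice z h /\ h <> 0] in
  let alias (k h : {ffun 'I_d -> int}) : R[i] :=
    \sum_(s : {ffun 'I_d -> bool})
      fhat f (absv (sgn_act s h + k)) *
      (Num.sqrt 2 ^ (- (nnz (sgn_act s h + k))%:Z + (nnz k)%:Z) / 2 ^+ d)%:C%C
  in
  (forall k, H k -> csummable dual0 (alias k)) /\
  L2normsq (fun x => f x - lattice_approx z alpha gamma M f x) =
    (\esum_(k in Zplus (d := d) `\` H) (normc (fhat f k) ^+ 2)%:E +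
     (\sum_(k \in H) normc (csum dual0 (alias k)) ^+ 2)%:E)%E.
Proof.
move=> H dual0 alias.
have gamma1 j : gamma j <= 1.
  by elim: j => [//|j IH]; exact: le_trans (gamma_noninc j) IH.
have alias_sum k : H k -> has_csum (fun h => if h \in dual0 then alias k h else 0)
    (lattice_coef z f k - fhat f k).
  by move=> [k0 _]; exact: (alias_has_csum z n_gt0 alpha_gt gamma1 gamma_gt0 f_cosine).
split; first by move=> k /alias_sum; exact: has_csum_csummable.
(* Finiteness ensures that the sums over [H], in the algorithm and in the formula, are genuine sums
   and not the default value 0. *)
have finH : finite_set H.
  by apply: finite_hyperbolic_cross => //; exact: lt_le_trans M_ge1.
pose s := finmap.enum_fset (fset_set H).
have sH : [set` s] = H.
  by apply/seteqP; split => k; rewrite /= in_fset_set// inE.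
have Zs k : k \in s -> Zplus k.
  by move=> ks; have [] : H k by rewrite -sH.
have us : uniq s by exact: finmap.fset_uniq.
have -> : (fun x => f x - lattice_approx z alpha gamma M f x) =
    (fun x => f x - \sum_(k <- s) lattice_coef z f k * (phi k x)%:C%C).
  apply/funext => x; congr (_ - _).
  by rewrite /lattice_approx -/H -[in LHS]sH -fsbig_seq.
rewrite parseval_sub_sum//; last by case: f_cosine.
rewrite sH; congr (_ + _)%E.
rewrite -[in RHS]sH -fsbig_seq// -sumEFin big_seq [RHS]big_seq.
apply: eq_bigr => k ks.
have Hk : H k by rewrite -sH.
(* Parseval yields f^(k) minus the lattice coefficient, the aliasing sum is the opposite; only the
   modulus matters. *)
by rewrite (has_csumE (alias_sum k Hk)) -[in RHS]normcN opprB.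
Qed.
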